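(* Let $r,r',p,p',q,q'$ be integers with $\max(0,r-1)\le r'\le r$, $r+r'\ge1$, $\max(0,p-1)\le p'\le p$, $p+p'\ge1$, $\max(0,q-1)\le q'\le q$, $q+q'\ge1$. Consider the hybrid-variable semi-discretization $$\overline{w}'_{j+1/2}+\frac{c}{h}(w_{j+1}-w_j)-\frac{\nu}{h}\left([\mathcal{D}_x^cw]_{j+1}-[\mathcal{D}_x^cw]_j\right)=0,\qquad w'_j+c[\mathcal{D}_xw]_j-\nu[\mathcal{D}_{xx}^cw]_j=0$$ of $w_t+cw_x-\nu w_{xx}=0$ on a periodic interval, where $[\mathcal{D}_x]$ is the central operator with stencil $(r,r')$, $[\mathcal{D}_x^c]$ is the central operator with stencil $(p,p')$, and $[\mathcal{D}_{xx}^c]$ is the central operator with stencil $(q,q')$, all with the optimal coefficients given in the context. Then the resulting ODE system is stable for all $h>0$ and all $\mathrm{Pe}\ge0$; that is, for every number of cells $N$ and every $\mathrm{Pe}\ge0$, the matrix $\boldsymbol{M}=-\mathrm{Pe}\,\boldsymbol{D}+\boldsymbol{K}$ is stable.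
   Context: The domain $[0,L]$ with periodic boundary conditions is divided into $N$ cells of size $h=L/N$; $x_j=jh$, indices modulo $N$; $w_j$ are nodal unknowns, $\overline{w}_{j+1/2}$ cell-averaged unknowns. $\nu>0$ and the cell Péclet number is $\mathrm{Pe}=ch/\nu$. Constants: for integers $l,r\ge0$, $-l\le\nu\le r$: $\zeta_\nu^{l,r}=H_{l+\nu}-H_{r-\nu}$, $C_\nu^{l,r}=\frac{l!\,r!}{(l+\nu)!(r-\nu)!}$, $H_n=1+\frac12+\cdots+\frac1n$, $H_0=0$. $\delta$ is the Kronecker delta; empty sums are zero. $[\mathcal{D}_x^cw]_j=\frac1h\sum_{k=-p}^{p-1}\alpha_k^c\overline{w}_{j+k+1/2}+\frac1h\sum_{k=-p'}^{p'}\beta_k^cw_{j+k}$ with $\alpha_\nu^c=-\alpha_{-1-\nu}^c$ for $-p\le\nu<0$; $\alpha_\nu^c=\sum_{k=\nu+1}^{p'}\frac{2(1+k(\zeta_k^{p,p}+\zeta_k^{p',p'}))}{k^2}C_k^{p,p}C_k^{p',p'}+(1-\delta_{pp'})\frac{2}{p^2}C_p^{p,p}C_p^{p',p}$ for $0\le\nu\le p-1$; $\beta_0^c=0$; $\beta_\nu^c=-\frac{2}{\nu}C_\nu^{p,p}C_\nu^{p',p'}$ for $-p'\le\nu\le p'$, $\nu\ne0$. $[\mathcal{D}_xw]_j=\frac1h\sum_{k=-r}^{r-1}\alpha_k\overline{w}_{j+k+1/2}+\frac1h\sum_{k=-r'}^{r'}\beta_kw_{j+k}$, where $\alpha_k,\beta_k$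 are given by the same formulas as $\alpha_k^c,\beta_k^c$ with $p,p'$ replaced by $r,r'$. $[\mathcal{D}_{xx}^cw]_j=\frac1{h^2}\sum_{k=-q}^{q-1}a_k\overline{w}_{j+k+1/2}+\frac1{h^2}\sum_{k=-q'}^{q'}b_kw_{j+k}$ with $a_\nu=a_{-1-\nu}$ for $-q\le\nu<0$; $a_\nu=\sum_{k=\nu+1}^{q'}\frac{6(2+k(\zeta_k^{q,q}+\zeta_k^{q',q'}))}{k^3}C_k^{q,q}C_k^{q',q'}+(1-\delta_{qq'})\frac{6}{q^3}C_q^{q,q}C_q^{q',q}$ for $0\le\nu\le q-1$; $b_0=-\sum_{-q\le k\le q,k\ne0}\frac{3}{k^2}-\sum_{-q'\le k\le q',k\ne0}\frac{3}{k^2}$; $b_\nu=-\frac{6}{\nu^2}C_\nu^{q,q}C_\nu^{q',q'}$ for $-q'\le\nu\le q'$, $\nu\ne0$. Matrix form: with $\boldsymbol{w}=[\overline{w}_{1/2},\dots,\overline{w}_{N-1/2},w_0,\dots,w_{N-1}]^T$ the system is $\boldsymbol{w}'=\frac{\nu}{h^2}\boldsymbol{M}\boldsymbol{w}$, $\boldsymbol{M}=-\mathrm{Pe}\,\boldsymbol{D}+\boldsymbol{K}$, where $$\boldsymbol{D}=\begin{bmatrix}\boldsymbol{0}&\boldsymbol{S}-\boldsymbol{I}\\ G(\boldsymbol{S})&H(\boldsymbol{S})\end{bmatrix},\qquad\boldsymbol{K}=\begin{bmatrix}(\boldsymbol{S}-\boldsymbol{I})G^c(\boldsymbol{S})&(\boldsymbol{S}-\boldsymbol{I})H^c(\boldsymbol{S})\\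 A(\boldsymbol{S})&B(\boldsymbol{S})\end{bmatrix},$$ $\boldsymbol{S}$ is the $N\times N$ cyclic shift matrix ($(\boldsymbol{S}v)_j=v_{j+1}$, indices mod $N$), and $G(s)=\sum_{k=-r}^{r-1}\alpha_ks^k$, $H(s)=\sum_{k=-r'}^{r'}\beta_ks^k$, $G^c(s)=\sum_{k=-p}^{p-1}\alpha_k^cs^k$, $H^c(s)=\sum_{k=-p'}^{p'}\beta_k^cs^k$, $A(s)=\sum_{k=-q}^{q-1}a_ks^k$, $B(s)=\sum_{k=-q'}^{q'}b_ks^k$. A square complex matrix is called stable if each of its eigenvalues $\lambda$ either has negative real part, or has $\mathrm{Re}\,\lambda=0$ and is simple. *)

(* Defs.v *)
From HB Require Import structures.
From mathcomp Require Import all_boot all_order all_algebra.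
From mathcomp Require Import reals complex.

Set Implicit Arguments.
Unset Strict Implicit.
Unset Printing Implicit Defensive.

Import Order.TTheory GRing.Theory Num.Theory.
Local Open Scope ring_scope.

(* \sum_(-a <= k < b) F k over integers k *)
Definition sumz (V : zmodType) (a b : nat) (F : int -> V) : V :=
  \sum_(i < a + b) F (i%:Z - a%:Z).

Section Coefficients.
Variable R : realType.

Definition harmonic_number (n : nat) : R := \sum_(1 <= i < n.+1) i%:R^-1.

(* zeta_k^{l,r} and C_k^{l,r}; meaningful only for - l <= k <= r, where the
   absolute values do nothing. *)
Definition zeta (l r : nat) (k : int) : R :=
  harmonic_number `|(l%:Z + k)%R|%N - harmonic_number `|(r%:Z - k)%R|%N.

Definition Ccoef (l r : nat) (k : int) : R :=
  (l`!)%:R * (r`!)%:R /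
  ((`|(l%:Z + k)%R|%N`!)%:R * (`|(r%:Z - k)%R|%N`!)%:R).

Definition alpha_nonneg (p p' n : nat) : R :=
  \sum_(n.+1 <= k < p'.+1)
     2 * (1 + k%:R * (zeta p p k + zeta p' p' k)) / k%:R ^+ 2 *
     Ccoef p p k * Ccoef p' p' k
  + (1 - (p == p')%:R) * (2 / p%:R ^+ 2) * Ccoef p p p * Ccoef p' p p.

(* [Negz n] is - 1 - n, so the second branch is alpha_k = - alpha_(-1-k). *)
Definition alpha (p p' : nat) (k : int) : R :=
  match k with
  | Posz n => alpha_nonneg p p' n
  | Negz n => - alpha_nonneg p p' n
  end.

Definition beta (p p' : nat) (k : int) : R :=
  if k == 0 then 0 else - (2 / k%:~R) * Ccoef p p k * Ccoef p' p' k.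

Definition a_nonneg (q q' n : nat) : R :=
  \sum_(n.+1 <= k < q'.+1)
     6 * (2 + k%:R * (zeta q q k + zeta q' q' k)) / k%:R ^+ 3 *
     Ccoef q q k * Ccoef q' q' k
  + (1 - (q == q')%:R) * (6 / q%:R ^+ 3) * Ccoef q q q * Ccoef q' q q.

Definition acoef (q q' : nat) (k : int) : R :=
  match k with
  | Posz n => a_nonneg q q' n
  | Negz n => a_nonneg q q' n
  end.

Definition bcoef (q q' : nat) (k : int) : R :=
  if k == 0 then
    - sumz q q.+1 (fun i => if i == 0 then 0 else 3 / i%:~R ^+ 2)
    - sumz q' q'.+1 (fun i => if i == 0 then 0 else 3 / i%:~R ^+ 2)
  else - (6 / k%:~R ^+ 2) * Ccoef q q k * Ccoef q' q' k.

End Coefficients.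

(* In this section N = n.+1 is the number of cells.  ['I_n.+1] is the additive
   group Z/NZ also when N = 1, with [inZp 1] the class of 1. *)
Section Scheme.
Variables (R : realType) (n : nat).
Implicit Types (wbar w : 'cV[R]_n.+1) (j : 'I_n.+1) (k : int) (h : R).

(* j + k modulo N *)
Definition shift_index j k : 'I_n.+1 := j + inZp 1 *~ k.

(* The entry [wbar j 0] is the cell average with index j + 1/2. *)
Definition Dx h (p p' : nat) wbar w j : R :=
  h^-1 * sumz p p (fun k => alpha R p p' k * wbar (shift_index j k) 0) +
  h^-1 * sumz p' p'.+1 (fun k => beta R p p' k * w (shift_index j k) 0).

Definition Dxx h (q q' : nat) wbar w j : R :=
  (h ^+ 2)^-1 * sumz q q (fun k => acoef R q q' k * wbar (shift_index j k) 0) +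
  (h ^+ 2)^-1 * sumz q' q'.+1 (fun k => bcoef R q q' k * w (shift_index j k) 0).

(* The autonomous ODE system, as a relation between the state
   W = [wbar; w] and its time derivative W'. *)
Definition semidiscretization (r r' p p' q q' : nat) (h c nu : R)
    (W W' : 'cV[R]_(n.+1 + n.+1)) : Prop :=
  let wbar := usubmx W in let w := dsubmx W in
  let wbar' := usubmx W' in let w' := dsubmx W' in
  forall j,
    wbar' j 0 + c / h * (w (shift_index j 1) 0 - w j 0)
      - nu / h * (Dx h p p' wbar w (shift_index j 1) - Dx h p p' wbar w j) = 0
    /\ w' j 0 + c * Dx h r r' wbar w j - nu * Dxx h q q' wbar w j = 0.

Definition cyclic_shift : 'M[R]_n.+1 :=
  \matrix_(i, j) (j == shift_index i 1)%:R.

(* \sum_(-a <= k < b) f_k S^k; S is invertible and [^] takes integer powers *)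
Definition laurent_shift (a b : nat) (f : int -> R) : 'M[R]_n.+1 :=
  sumz a b (fun k => f k *: cyclic_shift ^ k).

Definition Dmatrix (r r' : nat) : 'M[R]_(n.+1 + n.+1) :=
  block_mx 0 (cyclic_shift - 1)
    (laurent_shift r r (alpha R r r')) (laurent_shift r' r'.+1 (beta R r r')).

Definition Kmatrix (p p' q q' : nat) : 'M[R]_(n.+1 + n.+1) :=
  block_mx
    ((cyclic_shift - 1) * laurent_shift p p (alpha R p p'))
    ((cyclic_shift - 1) * laurent_shift p' p'.+1 (beta R p p'))
    (laurent_shift q q (acoef R q q'))
    (laurent_shift q' q'.+1 (bcoef R q q')).

Definition Mmatrix (r r' p p' q q' : nat) (Pe : R) : 'M[R]_(n.+1 + n.+1) :=
  - (Pe *: Dmatrix r r') + Kmatrix p p' q q'.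

End Scheme.

Section Stability.
Variable R : realType.

(* "Simple" is algebraic multiplicity one. *)
Definition stable_mx (m : nat) (A : 'M[R[i]]_m) : Prop :=
  forall lambda : R[i], eigenvalue A lambda ->
    complex.Re lambda < 0 \/
    complex.Re lambda = 0 /\ mup lambda (char_poly A) = 1%N.

(* [F] relates a state to its derivative: it is the system W' = A W for a
   (necessarily unique) real matrix A, and A is stable. *)
Definition stable_system (m : nat) (F : 'cV[R]_m -> 'cV[R]_m -> Prop) : Prop :=
  exists2 A : 'M[R]_m,
    (forall W W', F W W' <-> W' = A *m W)
    & stable_mx (map_mx (real_complex R) A).

End Stability.

(* Main.v *)
(* The matrix M is block circulant, so its characteristic polynomial is the
   product over the N-th roots of unity s = e^(it) of quadratics
   z^2 + (p1 + i q1) z + (p2 + i q2), and for s <> 1 the claim is the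
   Routh-Hurwitz condition p1 > 0, p1^2 p2 + p1 q1 q2 > q2^2.  After Abel
   summation all entries are expressed with real trigonometric sums F, rho, v, E,
   one family for each n = p + p'.

   With Phi(k) = C_k^{p,p} C_k^{p',p'} extended to real k, the sums
   P = sum Phi(k) e^(ikt) and V = t P + 2 sum_(k > 0) Phi'(k) sin(kt) satisfy
     sin(t/2) y'' = n cos(t/2) y' + p p' sin(t/2) y,
   a consequence of the hypergeometric recurrence of Phi and of its derivative in
   k.  Energy and Wronskian arguments on [0, pi] give P > 0 >= P' and
   V, V', V'' >= 0.  Moreover rho' = 2 P - 2 and (F - t rho)' = 2 t - 2 V, whence
   0 <= F - t rho <= t^2, while (t v - E)' = 3 (F - t rho) controls E and v.
   Passing from n to n + 1 increases rho, v and F - t rho.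

   The coefficient of Pe^2 in the Routh-Hurwitz condition is a concave quadratic
   f - y x - x^2 (f, y the sums F, rho of the convection stencil) evaluated at a
   barycentre of two points, one for each diffusion stencil.  For r + r' >= 2 it
   is nonnegative at both, since F >= t rho and
   E <= kap v with kap = (8 sin(t/2) - sin t) / 3; for r + r' = 1 one compares
   directly with f = 4 sin(t/2)^2. *)

Require Import Defs.
From mathcomp Require Import all_boot all_order all_algebra.
From mathcomp Require Import reals complex.
From mathcomp Require Import separable cyclotomic.
From mathcomp Require Import ring lra zify.
From mathcomp Require Import boolp classical_sets functions topology normedtype derive realfun trigo.
Import Order.TTheory GRing.Theory Num.Theory.
Import numFieldNormedType.Exports.
Local Open Scope ring_scope.

Set Implicit Arguments.
Unset Strict Implicit.
Unset Printing Implicit Defensive.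

(** * Monotonicity from derivatives *)

Section Monotonicity.
Variable R : realType.
Implicit Types (f g df dg : R -> R) (a b c x y : R).

(* Unlike [is_derive], not a type class, so that unification does not trigger
   instance search while derivatives are being computed. *)
Definition derives f x a : Prop := is_derive x (1 : R) f a.

Lemma derives_eq f x a b : derives f x a -> a = b -> derives f x b.
Proof. by move=> df <-. Qed.

Lemma derives_add f g x a b : derives f x a -> derives g x b ->
  derives (fun t => f t + g t) x (a + b).
Proof. exact: is_deriveD. Qed.

Lemma derives_opp f x a : derives f x a -> derives (fun t => - f t) x (- a).
Proof. exact: is_deriveN. Qed.

Lemma derives_mul f g x a b : derives f x a -> derives g x b ->
  derives (fun t => f t * g t) x (f x * b + g x * a).
Proof. exact: is_deriveM. Qed.

Lemma derives_exp f n x a : derives f x a ->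
  derives (fun t => f t ^+ n) x (n%:R * f x ^+ n.-1 * a).
Proof. by move=> df; have := is_deriveX n df; rewrite exprfctE. Qed.

Lemma derives_const c x : derives (fun=> c) x 0.
Proof. exact: is_derive_cst. Qed.

Lemma derives_id x : derives (fun t => t) x 1.
Proof. exact: is_derive_id. Qed.

Lemma derives_inv f x a : f x != 0 -> derives f x a ->
  derives (fun t => (f t)^-1) x (- (f x ^- 2) * a).
Proof.
move=> fx0 [df fa]; split; first exact: derivableV.
by rewrite deriveV // fa.
Qed.

Lemma derives_comp f g x a b : derives f (g x) a -> derives g x b ->
  derives (fun t => f (g t)) x (a * b).
Proof. exact: is_derive1_comp. Qed.

Lemma derives_cos f x a : derives f x a -> derives (fun t => cos (f t)) x (- sin (f x) * a).
Proof. exact/derives_comp/is_derive_cos. Qed.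

Lemma derives_sin f x a : derives f x a -> derives (fun t => sin (f t)) x (cos (f x) * a).
Proof. exact/derives_comp/is_derive_sin. Qed.

Lemma derives_sum (I : Type) (r : seq I) (F : I -> R -> R) (dF : I -> R) x :
  (forall i, derives (F i) x (dF i)) ->
  derives (fun t => \sum_(i <- r) F i t) x (\sum_(i <- r) dF i).
Proof.
move=> h; elim: r => [|i r ih].
  rewrite big_nil (_ : (fun t => _) = fun=> 0); first exact: derives_const.
  by apply/funext => t; rewrite big_nil.
rewrite big_cons (_ : (fun t => _) = fun t => F i t + \sum_(j <- r) F j t).
  exact: derives_add.
by apply/funext => t; rewrite big_cons.
Qed.

Lemma derives_continuous f df a b : (forall x, a <= x <= b -> derives f x (df x)) ->
  {within `[a, b], continuous f}%classic.
Proof.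
move=> dfE; apply: continuous_in_subspaceT => x.
rewrite inE /= in_itv /= => /dfE [fx _].
by apply/differentiable_continuous/derivable1_diffP.
Qed.

Lemma mean_value f df a b : a < b -> (forall x, a <= x <= b -> derives f x (df x)) ->
  exists2 x, a < x < b & f b - f a = df x * (b - a).
Proof.
move=> ab dfE; have [||x xab e] := MVT ab (f := f) (df := df).
- move=> x; rewrite in_itv /= => /andP[ax xb]; apply: dfE.
  by rewrite !ltW.
- exact: derives_continuous dfE.
- by exists x => //; move: xab; rewrite in_itv.
Qed.

Lemma le_of_derive_ge0 f df a b : a <= b ->
  (forall x, a <= x <= b -> derives f x (df x)) ->
  (forall x, a < x < b -> 0 <= df x) -> f a <= f b.
Proof.
rewrite le_eqVlt => /predU1P[-> //|ab] dfE df0.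
have [x /df0 x0 e] := mean_value ab dfE.
by rewrite -subr_ge0 e mulr_ge0 // subr_ge0 ltW.
Qed.

Lemma lt_of_derive_gt0 f df a b : a < b ->
  (forall x, a <= x <= b -> derives f x (df x)) ->
  (forall x, a < x < b -> 0 < df x) -> f a < f b.
Proof.
move=> ab dfE df0; have [x /df0 x0 e] := mean_value ab dfE.
by rewrite -subr_gt0 e mulr_gt0 // subr_gt0.
Qed.

(** If f x < 0, the mean value theorem gives a negative slope on [0, x] and a positive one on
    [x, b], against the monotonicity of [df]. *)
Lemma concave_ge0 f df b : (forall x, 0 <= x <= b -> derives f x (df x)) ->
  (forall x y, 0 <= x -> x <= y -> y <= b -> df y <= df x) ->
  f 0 = 0 -> f b = 0 -> forall x, 0 <= x <= b -> 0 <= f x.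
Proof.
move=> dfE dfm f0 fb x /andP[x0 xb].
move: x0; rewrite le_eqVlt => /predU1P[<-|x0]; first by rewrite f0.
move: xb; rewrite le_eqVlt => /predU1P[->|xb]; first by rewrite fb.
have [|y /andP[y0 yx] ey] := @mean_value f df 0 x x0.
  by move=> t /andP[t0 tx]; apply: dfE; rewrite t0 (le_trans tx) ?ltW.
have [|z /andP[z0 zx] ez] := @mean_value f df x b xb.
  by move=> t /andP[t0 tx]; apply: dfE; rewrite tx (le_trans _ t0) ?ltW.
have dyz : df z <= df y by apply: dfm; rewrite ?ltW // (lt_trans yx).
rewrite f0 !subr0 in ey; rewrite fb sub0r in ez.
rewrite leNgt; apply/negP => fx0.
have dy0 : df y < 0 by rewrite -(pmulr_llt0 _ x0) -ey.
have : df z * (b - x) < 0 by rewrite pmulr_llt0 ?subr_gt0 // (le_lt_trans dyz).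
by rewrite -ez oppr_lt0 => /(lt_trans fx0); rewrite ltxx.
Qed.

End Monotonicity.

Ltac derive := repeat first
  [ eassumption | apply: derives_const | apply: derives_id
  | apply: derives_add | apply: derives_opp | apply: derives_mul | apply: derives_exp
  | apply: derives_cos | apply: derives_sin | apply: derives_inv ].

(** * Stencil coefficients as solutions of a recurrence *)

Section Coefficients.
Variable R : realType.
Implicit Types (n k K : nat) (t : R) (c : nat -> R).

(* A stencil (p, p') with p - 1 <= p' <= p is determined by n = p + p', namely
   p = uphalf n and p' = n./2.  All quantities below are indexed by n. *)
Definition Acf n k : R := ((uphalf n)%:R + k%:R) * ((n./2)%:R + k%:R).
Definition Bcf n k : R := ((uphalf n)%:R - k%:R) * ((n./2)%:R - k%:R).

(* [phi n k] is Phi(k) = C_k^{p,p} C_k^{p',p'} and [psi n k] is - Phi'(k), where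
   Phi is extended to real k by the Gamma function.  The recurrences are
   A(k+1) Phi(k+1) = B(k) Phi(k) and its derivative in k. *)
Fixpoint phi n k : R := if k is k'.+1 then Bcf n k' / Acf n k * phi n k' else 1.

Fixpoint psi n k : R :=
  if k is k'.+1 then
    ((n%:R + 2 * k%:R) * phi n k + Bcf n k' * psi n k'
      + (n%:R - 2 * k'%:R) * phi n k') / Acf n k
  else 0.

Lemma natr_half n : n%:R = (uphalf n)%:R + (n./2)%:R :> R.
Proof. by rewrite -natrD uphalf_half -addnA addnn odd_double_half. Qed.

Lemma Acf_gt0 n k : 0 < Acf n k.+1.
Proof. by rewrite mulr_gt0 // ltr_wpDl. Qed.

Lemma phiS n k : Acf n k.+1 * phi n k.+1 = Bcf n k * phi n k.
Proof. by rewrite [phi _ _]/= mulrA [Acf _ _ * _]mulrC mulfVK ?gt_eqF ?Acf_gt0. Qed.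

Lemma psiS n k : Acf n k.+1 * psi n k.+1 =
  (n%:R + 2 * k.+1%:R) * phi n k.+1 + Bcf n k * psi n k + (n%:R - 2 * k%:R) * phi n k.
Proof. by rewrite [psi _ _]/= mulrC mulfVK ?gt_eqF ?Acf_gt0. Qed.

Lemma Bcf_half n : Bcf n n./2 = 0.
Proof. by rewrite /Bcf subrr mulr0. Qed.

Lemma phi_supp n k : (n./2 < k)%N -> phi n k = 0.
Proof.
elim: k => // k ih; rewrite ltnS leq_eqVlt => /predU1P[<-|/ih e].
  by rewrite /= Bcf_half !mul0r.
by rewrite /= e mulr0.
Qed.

(** The support of Phi' can exceed that of Phi by one step: when p = p' + 1, Phi has a simple zero
    at k = p and double zeros only after it. *)
Lemma psi_supp n k : (uphalf n < k)%N -> psi n k = 0.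
Proof.
elim: k => // k ih; rewrite ltnS => nk.
have hk : (n./2 <= k)%N by rewrite (leq_trans _ nk) // uphalf_half leq_addl.
rewrite /= -/(phi n k.+1) phi_supp // mulr0 add0r.
move: nk; rewrite leq_eqVlt => /predU1P[e|/[dup] nk /ih ->].
  (* At k = p only (n - 2 k) Phi(k) is left; the first factor vanishes if p = p', and Phi(p) = 0 if
     p = p' + 1. *)
  rewrite /Bcf -e subrr !mul0r add0r; move: hk; rewrite -e leq_eqVlt.
  move=> /predU1P[e'|/phi_supp ->]; last by rewrite mulr0 mul0r.
  by rewrite natr_half e' mulr_natl mulr2n subrr mul0r mul0r.
rewrite phi_supp ?mulr0 ?add0r ?mul0r //.
by rewrite (leq_ltn_trans _ nk) // uphalf_half leq_addl.
Qed.

(** Passing from n to n + 1 keeps one half-index and raises the other to m = [uphalf n.+1]; the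
    factor comes from C_k^{m-1,m-1} = (1 - k^2 / m^2) C_k^{m,m}. *)
Lemma phi_pred n k :
  phi n k = phi n.+1 k * (1 - k%:R ^+ 2 / (uphalf n.+1)%:R ^+ 2).
Proof.
have -> : uphalf n.+1 = n./2.+1 by [].
have a0 : 0 <= (n./2)%:R :> R by [].
have b0 : 0 <= (uphalf n)%:R :> R by [].
elim: k => [|k ih]; first by rewrite expr0n /= mul0r subr0 mulr1.
have A1 := Acf_gt0 n k; have A2 := Acf_gt0 n.+1 k.
apply: (mulfI (lt0r_neq0 A1)); rewrite phiS ih; apply: (mulfI (lt0r_neq0 A2)).
rewrite [RHS](_ : _ = Acf n k.+1 * (Acf n.+1 k.+1 * phi n.+1 k.+1) *
  (1 - k.+1%:R ^+ 2 / n./2.+1%:R ^+ 2)); last by ring.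
rewrite phiS /Acf /Bcf /= -!natr1; field.
by rewrite gt_eqF // ltr_wpDl.
Qed.

(** Induction step of [psi_pred] as an identity of rational functions: the residual for n is a
    combination of the residuals of the two recurrences for n + 1. *)
Lemma psi_pred_step (a b k f g x y : R) : a + 1 != 0 ->
  (a + 1 + (k + 1)) * (b + (k + 1)) * x = (a + 1 - k) * (b - k) * f ->
  (a + 1 + (k + 1)) * (b + (k + 1)) * y =
    (a + 1 + b + 2 * (k + 1)) * x + (a + 1 - k) * (b - k) * g + (a + 1 + b - 2 * k) * f ->
  (b + (k + 1)) * (a + (k + 1)) *
    (y * (1 - (k + 1) ^+ 2 / (a + 1) ^+ 2) + 2 * (k + 1) * x / (a + 1) ^+ 2) =
  (b + a + 2 * (k + 1)) * (x * (1 - (k + 1) ^+ 2 / (a + 1) ^+ 2))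
  + (b - k) * (a - k) * (g * (1 - k ^+ 2 / (a + 1) ^+ 2) + 2 * k * f / (a + 1) ^+ 2)
  + (b + a - 2 * k) * (f * (1 - k ^+ 2 / (a + 1) ^+ 2)).
Proof.
move=> a0 /eqP; rewrite -subr_eq0 => /eqP ex /eqP; rewrite -subr_eq0 => /eqP ey.
apply: subr0_eq.
transitivity ((a + 1 + k) * (a - k) / (a + 1) ^+ 2 *
   ((a + 1 + (k + 1)) * (b + (k + 1)) * y - ((a + 1 + b + 2 * (k + 1)) * x
     + (a + 1 - k) * (b - k) * g + (a + 1 + b - 2 * k) * f))
   + (2 * k + 1) / (a + 1) ^+ 2 *
   ((a + 1 + (k + 1)) * (b + (k + 1)) * x - (a + 1 - k) * (b - k) * f)).
  by field.
by rewrite ex ey !mulr0 addr0.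
Qed.

(** This is minus the derivative of [phi_pred] in k. *)
Lemma psi_pred n k : psi n k =
  psi n.+1 k * (1 - k%:R ^+ 2 / (uphalf n.+1)%:R ^+ 2)
  + 2 * k%:R * phi n.+1 k / (uphalf n.+1)%:R ^+ 2.
Proof.
have eU : (uphalf n.+1)%:R = (n./2)%:R + 1 :> R by rewrite natr1.
elim: k => [|k ih]; first by rewrite /= mulr0 !mul0r addr0.
apply: (mulfI (lt0r_neq0 (Acf_gt0 n k))); rewrite psiS ih !(phi_pred n).
have := phiS n.+1 k; have := psiS n.+1 k.
rewrite /Acf /Bcf (natr_half n.+1) (natr_half n) eU -!(natr1 k).
rewrite (_ : n.+1./2 = uphalf n) // => ey ex; apply/esym/psi_pred_step => //.
by rewrite natr1 pnatr_eq0.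
Qed.

End Coefficients.

(** * Trigonometric sums and their differential equation *)

Section TrigSums.
Variable R : realType.
Implicit Types (n k K : nat) (t : R) (c : nat -> R).

(** The cutoff K only has to exceed the support of c, so one K can serve all stencils at once. *)
Definition csum K c t : R := \sum_(1 <= k < K) c k * cos (k%:R * t).
Definition ssum K c t : R := \sum_(1 <= k < K) c k * sin (k%:R * t).

Lemma derives_csum K c t : derives (csum K c) t (- ssum K (fun k => k%:R * c k) t).
Proof.
rewrite /ssum -sumrN; apply: derives_sum => k.
by apply: derives_eq; [derive | rewrite /=; ring].
Qed.

Lemma derives_ssum K c t : derives (ssum K c) t (csum K (fun k => k%:R * c k) t).
Proof.
apply: derives_sum => k.
by apply: derives_eq; [derive | rewrite /=; ring].
Qed.

Lemma csum_ext K c c' t : (forall k, (0 < k)%N -> c k = c' k) -> csum K c t = csum K c' t.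
Proof. by move=> e; apply: eq_big_nat => k /andP[k0 _]; rewrite e. Qed.

Lemma ssum_ext K c c' t : (forall k, (0 < k)%N -> c k = c' k) -> ssum K c t = ssum K c' t.
Proof. by move=> e; apply: eq_big_nat => k /andP[k0 _]; rewrite e. Qed.

Lemma csumD K c c' t : csum K (fun k => c k + c' k) t = csum K c t + csum K c' t.
Proof. by rewrite /csum -big_split; apply: eq_bigr => k _; rewrite mulrDl. Qed.

Lemma ssumD K c c' t : ssum K (fun k => c k + c' k) t = ssum K c t + ssum K c' t.
Proof. by rewrite /ssum -big_split; apply: eq_bigr => k _; rewrite mulrDl. Qed.

Lemma csumZ K a c t : csum K (fun k => a * c k) t = a * csum K c t.
Proof. by rewrite /csum mulr_sumr; apply: eq_bigr => k _; rewrite mulrA. Qed.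

Lemma ssumZ K a c t : ssum K (fun k => a * c k) t = a * ssum K c t.
Proof. by rewrite /ssum mulr_sumr; apply: eq_bigr => k _; rewrite mulrA. Qed.

Lemma ssum0 K c : ssum K c 0 = 0.
Proof. by rewrite /ssum big1 // => k _; rewrite mulr0 sin0 mulr0. Qed.

Lemma sin_natpi k : sin (k%:R * pi) = 0 :> R.
Proof.
elim: k => [|k ih]; first by rewrite mul0r sin0.
by rewrite -natr1 mulrDl mul1r sinDpi ih oppr0.
Qed.

Lemma ssumpi K c : ssum K c pi = 0.
Proof. by rewrite /ssum big1 // => k _; rewrite sin_natpi mulr0. Qed.

Lemma csumS K c t : csum K.+2 c t = csum K.+1 c t + c K.+1 * cos (K.+1%:R * t).
Proof. by rewrite /csum big_nat_recr. Qed.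

Lemma ssumS K c t : ssum K.+2 c t = ssum K.+1 c t + c K.+1 * sin (K.+1%:R * t).
Proof. by rewrite /ssum big_nat_recr. Qed.

Lemma csum1 c t : csum 1 c t = 0. Proof. by rewrite /csum big_geq. Qed.
Lemma ssum1 c t : ssum 1 c t = 0. Proof. by rewrite /ssum big_geq. Qed.

Local Notation phi := (@phi R).
Local Notation psi := (@psi R).

(* The differences alpha_(k-1) - alpha_k = - 2 (Phi(k) / k)' and
   a_(k-1) - a_k = - 6 (Phi(k) / k^2)'. *)
Definition dcf n k : R := 2 * phi n k / k%:R ^+ 2 + 2 * psi n k / k%:R.
Definition ecf n k : R := 12 * phi n k / k%:R ^+ 3 + 6 * psi n k / k%:R ^+ 2.

(* Phi is the Fourier transform of an even W supported on [-2 pi, 2 pi]; on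
   [0, 2 pi], Pf is the periodization W(t) + W(2 pi - t), and Vf is
   2 pi W(2 pi - t) because Phi' is the transform of a multiple of x W(x). *)
Definition Pf K n t := 1 + 2 * csum K (phi n) t.
Definition P1f K n t := - 2 * ssum K (fun k => k%:R * phi n k) t.
Definition P2f K n t := - 2 * csum K (fun k => k%:R * (k%:R * phi n k)) t.

Definition Vf K n t := t * Pf K n t - 2 * ssum K (psi n) t.
Definition V1f K n t := Pf K n t + t * P1f K n t - 2 * csum K (fun k => k%:R * psi n k) t.
Definition V2f K n t :=
  2 * P1f K n t + t * P2f K n t + 2 * ssum K (fun k => k%:R * (k%:R * psi n k)) t.

(* At s = e^(it) the symbols of the paper are H = - i rhof, (s - 1) G = - Ff,
   B = - vf and (s - 1) A = i Ef. *)
Definition rhof K n t := 4 * ssum K (fun k => phi n k / k%:R) t.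
Definition Ff K n t := 2 * (csum K (dcf n) 0 - csum K (dcf n) t).
Definition vf K n t :=
  6 * csum K (dcf n) 0 + 12 * csum K (fun k => phi n k / k%:R ^+ 2) t.
Definition Ef K n t := 2 * ssum K (ecf n) t.

Lemma derives_P K n t : derives (Pf K n) t (P1f K n t).
Proof.
by apply: derives_eq; [derive; exact: derives_csum | rewrite /P1f; ring].
Qed.

Lemma derives_P1 K n t : derives (P1f K n) t (P2f K n t).
Proof.
by apply: derives_eq; [derive; exact: derives_ssum | rewrite /P2f; ring].
Qed.

Lemma derives_V K n t : derives (Vf K n) t (V1f K n t).
Proof.
have dP := derives_P K n t; apply: derives_eq; first by derive; exact: derives_ssum.
by rewrite /V1f; ring.
Qed.

Lemma derives_V1 K n t : derives (V1f K n) t (V2f K n t).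
Proof.
have dP := derives_P K n t; have dP1 := derives_P1 K n t.
apply: derives_eq; first by derive; exact: derives_csum.
by rewrite /V2f; ring.
Qed.

Lemma derives_rho K n t : derives (rhof K n) t (2 * Pf K n t - 2).
Proof.
apply: derives_eq; first by derive; exact: derives_ssum.
rewrite (csum_ext K _ (c' := phi n)); first by rewrite /Pf; ring.
by move=> k k0; rewrite mulrC divfK // pnatr_eq0 -lt0n.
Qed.

Lemma derives_F K n t :
  derives (Ff K n) t (rhof K n t + 2 * (t * Pf K n t - Vf K n t)).
Proof.
apply: derives_eq; first by derive; exact: derives_csum.
rewrite (ssum_ext K _ (c' := fun k => 2 * (phi n k / k%:R) + 2 * psi n k)).
  by rewrite ssumD !ssumZ /rhof /Vf; ring.
by move=> k k0; rewrite /dcf; field; rewrite pnatr_eq0 -lt0n.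
Qed.

Lemma derives_v K n t : derives (vf K n) t (- 3 * rhof K n t).
Proof.
apply: derives_eq; first by derive; exact: derives_csum.
rewrite (ssum_ext K _ (c' := fun k => phi n k / k%:R)); first by rewrite /rhof; ring.
by move=> k k0; field; rewrite pnatr_eq0 -lt0n.
Qed.

Lemma derives_E K n t : derives (Ef K n) t (vf K n t - 3 * Ff K n t).
Proof.
apply: derives_eq; first by derive; exact: derives_ssum.
rewrite (csum_ext K _ (c' := fun k => 6 * (phi n k / k%:R ^+ 2) + 3 * dcf n k)).
  by rewrite csumD !csumZ /vf /Ff; ring.
by move=> k k0; rewrite /ecf /dcf; field; rewrite pnatr_eq0 -lt0n.
Qed.

Definition ode K n (y y1 y2 : R -> R) t : R :=
  sin (t / 2) * y2 t - n%:R * cos (t / 2) * y1 t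
  - (uphalf n)%:R * (n./2)%:R * sin (t / 2) * y t.

(* Written with phases k t - t / 2, the recurrence for Phi makes the residual of
   the differential equation telescope; the recurrence for Phi' does so for V. *)
Lemma P_ode_partial K n t : (0 < K)%N -> ode K n (Pf K n) (P1f K n) (P2f K n) t =
  - (Acf R n K * phi n K * sin (K%:R * t - t / 2)).
Proof.
case: K => // K _; elim: K => [|K ih].
  rewrite phiS /ode /Pf /P1f /P2f !csum1 !ssum1 /Bcf /= mul1r.
  by rewrite (_ : t - t / 2 = t / 2); [ring | field].
transitivity (ode K.+1 n (Pf K.+1 n) (P1f K.+1 n) (P2f K.+1 n) t
  + phi n K.+1 * (2 * n%:R * K.+1%:R * sin (K.+1%:R * t) * cos (t / 2)
   - 2 * ((uphalf n)%:R * (n./2)%:R + K.+1%:R ^+ 2) * cos (K.+1%:R * t) * sin (t / 2))).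
  by rewrite /ode /Pf /P1f /P2f !(csumS, ssumS); ring.
rewrite ih (phiS R n K.+1) (_ : K.+2%:R * t - t / 2 = K.+1%:R * t + t / 2); last first.
  by rewrite -(natr1 K.+1); field.
by rewrite sinB sinD /Acf /Bcf (natr_half _ n); ring.
Qed.

Lemma V_ode_partial K n t : (0 < K)%N -> ode K n (Vf K n) (V1f K n) (V2f K n) t =
  t * ode K n (Pf K n) (P1f K n) (P2f K n) t
  + ((n%:R + 2 * K%:R) * phi n K - Acf R n K * psi n K) * cos (K%:R * t - t / 2).
Proof.
case: K => // K _; elim: K => [|K ih].
  rewrite psiS /ode /Vf /V1f /V2f /Pf /P1f /P2f !csum1 !ssum1 /Bcf [psi n 0]/= [phi n 0]/=.
  by rewrite (_ : 1 * t - t / 2 = t / 2); [ring | field].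
transitivity (ode K.+1 n (Vf K.+1 n) (V1f K.+1 n) (V2f K.+1 n) t
  - t * ode K.+1 n (Pf K.+1 n) (P1f K.+1 n) (P2f K.+1 n) t
  + t * ode K.+2 n (Pf K.+2 n) (P1f K.+2 n) (P2f K.+2 n) t
  - phi n K.+1 * (4 * K.+1%:R * sin (K.+1%:R * t) * sin (t / 2)
      + 2 * n%:R * cos (K.+1%:R * t) * cos (t / 2))
  + psi n K.+1 * (2 * n%:R * K.+1%:R * cos (K.+1%:R * t) * cos (t / 2)
   + 2 * ((uphalf n)%:R * (n./2)%:R + K.+1%:R ^+ 2) * sin (K.+1%:R * t) * sin (t / 2))).
  by rewrite /ode /Vf /V1f /V2f /Pf /P1f /P2f !(csumS, ssumS); ring.
rewrite ih [X in _ = _ + (_ - X) * _]psiS.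
rewrite (_ : K.+2%:R * t - t / 2 = K.+1%:R * t + t / 2); last first.
  by rewrite -(natr1 K.+1); field.
by rewrite cosB cosD /Acf /Bcf (natr_half _ n); ring.
Qed.

Lemma P_ode K n t : (uphalf n < K)%N -> ode K n (Pf K n) (P1f K n) (P2f K n) t = 0.
Proof.
move=> nK; rewrite P_ode_partial; last exact: leq_ltn_trans nK.
by rewrite phi_supp ?mulr0 ?mul0r ?oppr0 // (leq_ltn_trans _ nK) // uphalf_half leq_addl.
Qed.

Lemma V_ode K n t : (uphalf n < K)%N -> ode K n (Vf K n) (V1f K n) (V2f K n) t = 0.
Proof.
move=> nK; rewrite V_ode_partial; last exact: leq_ltn_trans nK.
rewrite P_ode // psi_supp // phi_supp; first by ring.
by rewrite (leq_ltn_trans _ nK) // uphalf_half leq_addl.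
Qed.

End TrigSums.

(** * Passing from n to n + 1, and the smallest stencils *)

Section Recursion.
Variables (R : realType) (K : nat).
Implicit Types (n k : nat) (t : R) (c : nat -> R).

Local Notation phi := (@phi R).
Local Notation psi := (@psi R).
Local Notation P := (@Pf R K).
Local Notation P1 := (@P1f R K).
Local Notation P2 := (@P2f R K).
Local Notation V := (@Vf R K).
Local Notation V1 := (@V1f R K).
Local Notation V2 := (@V2f R K).
Local Notation rho := (@rhof R K).
Local Notation F := (@Ff R K).
Local Notation v := (@vf R K).
Local Notation E := (@Ef R K).

(* Consistency of the operator makes this t ^ 2 up to a high power of t. *)
Definition Psif n t : R := F n t - t * rho n t.
Local Notation Psi := Psif.

(** At t = 0 the differential equation of V leaves only n V'(0) = 0. *)
Lemma V1_0 n : (0 < n)%N -> (uphalf n < K)%N -> V1 n 0 = 0.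
Proof.
move=> n0 nK; have := V_ode (0 : R) nK; rewrite /ode mul0r sin0 cos0.
rewrite !(mul0r, mulr0, mulr1, sub0r, subr0) => /eqP.
by rewrite oppr_eq0 mulf_eq0 pnatr_eq0 gtn_eqF //= => /eqP.
Qed.

(** On trigonometric sums the factor 1 - k^2 / m^2 of [phi_pred] acts as 1 + m^(-2) d^2/dt^2. In the
    same way the increments of rho, Psi and v below are multiples of P', V' and P. *)
Lemma P_pred n t : P n t = P n.+1 t + P2 n.+1 t / (uphalf n.+1)%:R ^+ 2.
Proof.
have U0 : (uphalf n.+1)%:R != 0 :> R by rewrite pnatr_eq0.
rewrite /Pf /P2f; rewrite (csum_ext K _ (c' := fun k => phi n.+1 k +
  (- ((uphalf n.+1)%:R ^- 2)) * (k%:R * (k%:R * phi n.+1 k)))).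
  by rewrite csumD csumZ; field.
by move=> k _; rewrite phi_pred; field.
Qed.

Lemma rho_succ n t : rho n.+1 t = rho n t - 2 * P1 n.+1 t / (uphalf n.+1)%:R ^+ 2.
Proof.
have U0 : (uphalf n.+1)%:R != 0 :> R by rewrite pnatr_eq0.
rewrite /rhof /P1f (ssum_ext K _ (c := fun k => phi n k / k%:R)
  (c' := fun k => phi n.+1 k / k%:R + (- ((uphalf n.+1)%:R ^- 2)) * (k%:R * phi n.+1 k))).
  by rewrite ssumD ssumZ; field.
by move=> k k0; rewrite phi_pred; field; rewrite U0 pnatr_eq0 -lt0n.
Qed.

Lemma csum_d_pred n t : csum K (dcf R n) t = csum K (dcf R n.+1) t
  - 2 / (uphalf n.+1)%:R ^+ 2 *
    (csum K (fun k => k%:R * psi n.+1 k) t - csum K (phi n.+1) t).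
Proof.
have U0 : (uphalf n.+1)%:R != 0 :> R by rewrite pnatr_eq0.
rewrite (csum_ext K _ (c := dcf R n) (c' := fun k => dcf R n.+1 k +
  (- (2 / (uphalf n.+1)%:R ^+ 2) * (k%:R * psi n.+1 k) +
  (2 / (uphalf n.+1)%:R ^+ 2) * phi n.+1 k))).
  by rewrite !csumD !csumZ; ring.
move=> k k0; rewrite /dcf phi_pred psi_pred; field.
by rewrite U0 pnatr_eq0 -lt0n.
Qed.

(** V'(0) = 0 relates the two sums at 0 left by [csum_d_pred]: their difference is 1/2. *)
Lemma csum_d0_succ n : (uphalf n.+1 < K)%N ->
  csum K (dcf R n.+1) 0 = csum K (dcf R n) 0 + (uphalf n.+1)%:R ^- 2.
Proof.
move=> nK; have U0 : (uphalf n.+1)%:R != 0 :> R by rewrite pnatr_eq0.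
have := V1_0 (ltn0Sn n) nK; rewrite /V1f /Pf mul0r addr0 => e.
rewrite (csum_d_pred n); move: e.
set x := csum K (phi n.+1) 0; set y := csum K (fun k => _) 0 => e.
by rewrite (_ : y = (1 + 2 * x) / 2); [field | lra].
Qed.

Lemma Psi_succ n t : (uphalf n.+1 < K)%N ->
  Psi n.+1 t = Psi n t + 2 * V1 n.+1 t / (uphalf n.+1)%:R ^+ 2.
Proof.
move=> nK; have U0 : (uphalf n.+1)%:R != 0 :> R by rewrite pnatr_eq0.
rewrite /Psif rho_succ /Ff (csum_d0_succ nK) (csum_d_pred n t) /V1f /Pf.
by field.
Qed.

Lemma v_succ n t : (uphalf n.+1 < K)%N ->
  v n.+1 t = v n t + 6 * P n.+1 t / (uphalf n.+1)%:R ^+ 2.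
Proof.
move=> nK; have U0 : (uphalf n.+1)%:R != 0 :> R by rewrite pnatr_eq0.
rewrite /vf (csum_d0_succ nK) (csum_ext K _ (c := fun k => phi n k / k%:R ^+ 2)
  (c' := fun k => phi n.+1 k / k%:R ^+ 2 + (- ((uphalf n.+1)%:R ^- 2)) * phi n.+1 k)).
  by rewrite [in 12 * csum _ (fun k => _ + _) _]csumD csumZ /Pf; field.
by move=> k k0; rewrite phi_pred; field; rewrite U0 pnatr_eq0 -lt0n.
Qed.

Lemma csum_single c t : (1 < K)%N -> (forall k, (1 < k)%N -> c k = 0) ->
  csum K c t = c 1 * cos t.
Proof.
move=> K1 c0; rewrite /csum big_ltn // big_nat big1 ?addr0 ?mul1r //.
by move=> k /andP[k1 _]; rewrite c0 // mul0r.
Qed.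

Lemma ssum_single c t : (1 < K)%N -> (forall k, (1 < k)%N -> c k = 0) ->
  ssum K c t = c 1 * sin t.
Proof.
move=> K1 c0; rewrite /ssum big_ltn // big_nat big1 ?addr0 ?mul1r //.
by move=> k /andP[k1 _]; rewrite c0 // mul0r.
Qed.

Lemma csum_eq0 c t : (forall k, (0 < k)%N -> c k = 0) -> csum K c t = 0.
Proof.
move=> c0; rewrite /csum big_nat big1 // => k /andP[k0 _].
by rewrite c0 // mul0r.
Qed.

Lemma ssum_eq0 c t : (forall k, (0 < k)%N -> c k = 0) -> ssum K c t = 0.
Proof.
move=> c0; rewrite /ssum big_nat big1 // => k /andP[k0 _].
by rewrite c0 // mul0r.
Qed.

Lemma phi0 k : (0 < k)%N -> phi 0 k = 0. Proof. by move=> k0; rewrite phi_supp. Qed.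
Lemma phi1 k : (0 < k)%N -> phi 1 k = 0. Proof. by move=> k0; rewrite phi_supp. Qed.
Lemma psi0 k : (0 < k)%N -> psi 0 k = 0. Proof. by move=> k0; rewrite psi_supp. Qed.
Lemma dcf0 k : (0 < k)%N -> dcf R 0 k = 0.
Proof. by move=> k0; rewrite /dcf phi0 // psi0 // !(mulr0, mul0r, addr0). Qed.

Lemma rho0 t : rho 0 t = 0.
Proof. by rewrite /rhof ssum_eq0 ?mulr0 // => k k0; rewrite phi0 ?mul0r. Qed.

Lemma rho1 t : rho 1 t = 0.
Proof. by rewrite /rhof ssum_eq0 ?mulr0 // => k k0; rewrite phi1 ?mul0r. Qed.

Lemma v0 t : v 0 t = 0.
Proof.
rewrite /vf (csum_eq0 _ dcf0) csum_eq0 ?mulr0 ?addr0 // => k k0.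
by rewrite phi0 ?mul0r.
Qed.

Lemma Psi0 t : Psi 0 t = 0.
Proof.
by rewrite /Psif rho0 /Ff !(csum_eq0 _ dcf0) !(subrr, mulr0).
Qed.

Lemma P0 t : P 0 t = 1.
Proof. by rewrite /Pf (csum_eq0 _ phi0) mulr0 addr0. Qed.

(** Closed forms for n = 1 and n = 2; monotonicity in n turns them into lower bounds for larger
    n. *)
Lemma Psi1 t : (1 < K)%N -> Psi 1 t = 2 * (1 - cos t).
Proof.
move=> K1; rewrite Psi_succ // Psi0 /V1f /Pf /P1f.
rewrite ssum_eq0; last by move=> k /phi1 ->; rewrite mulr0.
rewrite csum_eq0; last exact: phi1.
rewrite csum_single //; last by move=> k k1; rewrite psi_supp ?mulr0.
by rewrite [uphalf 1]/= [psi 1 1]/= /Acf /Bcf /=; field.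
Qed.

Lemma rho2 t : (1 < K)%N -> rho 2 t = sin t.
Proof.
move=> K1; rewrite /rhof ssum_single //=; first by rewrite /Acf /Bcf /=; field.
by move=> k k1; rewrite phi_supp ?mul0r.
Qed.

Lemma Psi2 t : (1 < K)%N -> Psi 2 t = 4 * (1 - cos t) - t * sin t.
Proof.
move=> K1; rewrite Psi_succ // Psi1 // /V1f /Pf /P1f.
rewrite ssum_single //; last by move=> k k1; rewrite phi_supp ?mulr0.
rewrite !csum_single //; last by move=> k k1; rewrite phi_supp.
  by rewrite [uphalf 2]/= [psi 2 1]/= [phi 2 1]/= /Acf /Bcf /=; field.
by move=> k k1; rewrite psi_supp ?mulr0.
Qed.

End Recursion.

(** * Positivity and convexity *)

Section Shape.
Variable R : realType.
Implicit Types (n k : nat) (a b t x : R) (f df : R -> R).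

Lemma sin_half_gt0 t : 0 < t <= pi -> 0 < sin (t / 2).
Proof.
move=> /andP[t0 tpi]; apply: sin_gt0_pi.
by rewrite divr_gt0 //= ltr_pdivrMr // (le_lt_trans tpi) // ltr_pMr ?pi_gt0 // ltr1n.
Qed.

Lemma cos_half_ge0 t : 0 <= t <= pi -> 0 <= cos (t / 2).
Proof.
move=> /andP[t0 tpi]; apply: cos_ge0_pihalf.
have := @pi_gt0 R; lra.
Qed.

(* A first order inequality for y is integrated after division by the
   integrating factor sin(t/2)^(2n). *)
Lemma integrating_factor n f df a b : 0 < a -> a <= b -> b <= pi ->
  (forall x, a <= x <= b -> derives f x (df x)) ->
  (forall x, a < x < b -> n%:R * cos (x / 2) * f x <= sin (x / 2) * df x) ->
  f a * sin (b / 2) ^+ n.*2 <= f b * sin (a / 2) ^+ n.*2.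
Proof.
move=> a0 ab bpi dfE dfge.
have s0 x : a <= x <= b -> 0 < sin (x / 2).
  by move=> /andP[ax xb]; apply: sin_half_gt0; rewrite (lt_le_trans a0) //= (le_trans xb).
pose s x := sin (x / 2) ^+ n.*2.
have sn0 x : a <= x <= b -> 0 < s x by move=> /s0; apply: exprn_gt0.
have hb : a <= b <= b by rewrite ab lexx.
have ha : a <= a <= b by rewrite ab lexx.
rewrite -ler_pdivrMr ?sn0 // mulrAC -ler_pdivlMr ?sn0 //.
apply: (le_of_derive_ge0 (f := fun x => f x / s x) (df := fun x =>
  (sin (x / 2) * df x - n%:R * cos (x / 2) * f x) / (s x * sin (x / 2))) ab).
  move=> x xab; have sx := s0 x xab; have dfx := dfE x xab.
  have snx := lt0r_neq0 (sn0 x xab).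
  have ds : derives s x (n%:R * cos (x / 2) * s x / sin (x / 2)).
    apply: derives_eq; first by rewrite /s; derive.
    rewrite /s /= -muln2 natrM; case: (n) => [|m]; first by rewrite !mul0r.
    by rewrite mulSn /= !exprS; field; exact: (lt0r_neq0 sx).
  apply: derives_eq; first by derive.
  by rewrite /=; field; rewrite snx lt0r_neq0.
move=> x xab; have /andP[ax xb] := xab.
have xab' : a <= x <= b by rewrite !ltW.
by rewrite divr_ge0 ?subr_ge0 ?dfge // mulr_ge0 // ltW ?sn0 ?s0.
Qed.

Variable K : nat.

Local Notation P := (@Pf R K).
Local Notation P1 := (@P1f R K).
Local Notation P2 := (@P2f R K).
Local Notation V := (@Vf R K).
Local Notation V1 := (@V1f R K).
Local Notation V2 := (@V2f R K).
Local Notation rho := (@rhof R K).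
Local Notation F := (@Ff R K).
Local Notation v := (@vf R K).
Local Notation E := (@Ef R K).

Lemma uphalf_ltW n : (uphalf n.+1 < K)%N -> (uphalf n < K)%N.
Proof. by apply: leq_ltn_trans; rewrite /= uphalf_half -add1n leq_add2r; case: odd. Qed.

(** At pi the differential equation reads P'' = p p' P, so [P_pred] gives P_n(pi) = (1 + p'/p)
    P_(n+1)(pi), with p, p' the half-indices of n + 1; the induction starts from P_0 = 1. *)
Lemma P_pi_bounds n : (uphalf n < K)%N -> 0 < P n pi <= 1.
Proof.
elim: n => [|n ih] nK; first by rewrite P0 ltr01 lexx.
have /andP[p0 p1] := ih (uphalf_ltW nK).
have := P_ode (pi : R) nK; rewrite /ode sin_pihalf cos_pihalf => ode.
have U0 : 0 < (uphalf n.+1)%:R :> R by rewrite ltr0n.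
have e : P n pi = P n.+1 pi * (1 + (n.+1./2)%:R / (uphalf n.+1)%:R).
  rewrite P_pred (_ : P2 n.+1 pi = (uphalf n.+1)%:R * (n.+1./2)%:R * P n.+1 pi).
    by field; exact: lt0r_neq0.
  by apply: subr0_eq; rewrite -ode; ring.
have q1 : 1 <= 1 + (n.+1./2)%:R / (uphalf n.+1)%:R :> R.
  by rewrite lerDl divr_ge0.
have P0 : 0 < P n.+1 pi by move: p0; rewrite e pmulr_lgt0 // (lt_le_trans _ q1).
by rewrite P0 (le_trans _ p1) // e ler_peMr // ltW.
Qed.

Lemma P1_pi n : P1 n pi = 0.
Proof. by rewrite /P1f ssumpi mulr0. Qed.

Lemma V_pi n : V n pi = pi * P n pi.
Proof. by rewrite /Vf ssumpi mulr0 subr0. Qed.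

Section FixedOrder.
Variable n : nat.
Hypotheses (n0 : (0 < n)%N) (nK : (uphalf n < K)%N).

Let ab : R := (uphalf n)%:R * (n./2)%:R.

Let ab_ge0 : 0 <= ab. Proof. by rewrite mulr_ge0. Qed.

Let odeP t : sin (t / 2) * P2 n t = n%:R * cos (t / 2) * P1 n t + ab * sin (t / 2) * P n t.
Proof. by have := P_ode t nK; rewrite /ode => e; apply: subr0_eq; rewrite -e /ab; ring. Qed.

Let odeV t : sin (t / 2) * V2 n t = n%:R * cos (t / 2) * V1 n t + ab * sin (t / 2) * V n t.
Proof. by have := V_ode t nK; rewrite /ode => e; apply: subr0_eq; rewrite -e /ab; ring. Qed.

(** The energy argument: by the differential equation P P' satisfies the inequality of
    [integrating_factor], with excess sin(t/2) (p p' P^2 + P'^2), and it vanishes at pi. *)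
Lemma PP1_le0 t : 0 < t <= pi -> P n t * P1 n t <= 0.
Proof.
move=> /[dup] ht /andP[t0 tpi].
have := @integrating_factor n (fun x => P n x * P1 n x)
  (fun x => P n x * P2 n x + P1 n x * P1 n x) t pi t0 tpi (lexx _).
rewrite P1_pi mulr0 mul0r sin_pihalf expr1n mulr1; apply.
  move=> x _; have dP := derives_P K n x; have dP1 := derives_P1 K n x.
  by apply: derives_eq; [derive | ].
move=> x /andP[tx xpi].
have s0 : 0 < sin (x / 2) by apply: sin_half_gt0; rewrite (lt_trans t0) //= ltW.
rewrite -subr_ge0 [X in 0 <= X](_ : _ = P n x * (sin (x / 2) * P2 n x)
  - n%:R * cos (x / 2) * (P n x * P1 n x) + sin (x / 2) * P1 n x ^+ 2); last by ring.
rewrite odeP [X in 0 <= X](_ : _ = sin (x / 2) * (ab * P n x ^+ 2 + P1 n x ^+ 2)); last by ring.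
apply: mulr_ge0; first exact: ltW.
by apply: addr_ge0; [apply: mulr_ge0 => // |]; exact: sqr_ge0.
Qed.

Lemma P_continuous a b : {within `[a, b], continuous (P n)}%classic.
Proof. by apply: (derives_continuous (df := P1 n)) => x _; exact: derives_P. Qed.

(* P^2 is nonincreasing and P(pi) > 0, so P has no zero. *)
Lemma P_gt0 t : 0 <= t <= pi -> 0 < P n t.
Proof.
have /andP[Ppi _] := P_pi_bounds nK.
have P_neq0 x : 0 <= x <= pi -> P n x != 0.
  move=> /andP[x0 xpi].
  have : - P n x ^+ 2 <= - P n pi ^+ 2.
    apply: (le_of_derive_ge0 (f := fun x => - P n x ^+ 2)
      (df := fun x => - 2 * (P n x * P1 n x)) xpi).
      move=> y _; have dP := derives_P K n y.
      by apply: derives_eq; [derive | rewrite /=; ring].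
    move=> y /andP[xy ypi]; have := @PP1_le0 y.
    rewrite (le_lt_trans x0 xy) (ltW ypi) => /(_ isT) ?.
    by rewrite mulNr oppr_ge0 pmulr_rle0.
  rewrite lerN2 => h; apply/eqP => e; move: h.
  by rewrite e expr0n /= leNgt exprn_gt0.
move=> /andP[t0 tpi]; rewrite lt_neqAle eq_sym P_neq0 ?t0 //= leNgt.
apply/negP => Pt; have [|c] := @IVT R (P n) t pi 0 tpi (@P_continuous t pi).
  by rewrite ge_min le_max (ltW Pt) (ltW Ppi) orbT.
rewrite in_itv /= => /andP[tc cpi] Pc.
by have := P_neq0 c; rewrite (le_trans t0 tc) cpi Pc eqxx => /(_ isT).
Qed.

Lemma P1_le0 t : 0 < t <= pi -> P1 n t <= 0.
Proof.
move=> /[dup] ht /andP[t0 tpi]; have := PP1_le0 ht.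
by rewrite pmulr_rle0 // P_gt0 // ltW.
Qed.

Lemma P_nincr x y : 0 <= x -> x <= y -> y <= pi -> P n y <= P n x.
Proof.
move=> x0 xy ypi; rewrite -lerN2.
apply: (le_of_derive_ge0 (f := fun x => - P n x) (df := fun x => - P1 n x) xy).
  by move=> z _; have dP := derives_P K n z; derive.
move=> z /andP[xz zy]; rewrite oppr_ge0 P1_le0 // (le_lt_trans x0 xz) /=.
by rewrite (le_trans (ltW zy)).
Qed.

Let W t := P n t * V1 n t - P1 n t * V n t.

Let derives_W t : derives W t (P n t * V2 n t - P2 n t * V n t).
Proof.
have dP := derives_P K n t; have dP1 := derives_P1 K n t.
have dV := derives_V K n t; have dV1 := derives_V1 K n t.
by apply: derives_eq; [rewrite /W; derive | ring].
Qed.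

(** Abel's identity for two solutions of the same equation; applying [integrating_factor] to W and
    to - W gives the two inequalities. *)
Let wronskian t : 0 < t <= pi -> W t = W pi * sin (t / 2) ^+ n.*2.
Proof.
move=> /andP[t0 tpi]; apply/eqP; rewrite eq_le.
have ode x : sin (x / 2) * (P n x * V2 n x - P2 n x * V n x) = n%:R * cos (x / 2) * W x.
  transitivity (P n x * (sin (x / 2) * V2 n x) - sin (x / 2) * P2 n x * V n x); first by ring.
  by rewrite odeP odeV /W; ring.
apply/andP; split.
  have := @integrating_factor n W (fun x => P n x * V2 n x - P2 n x * V n x) t pi t0 tpi (lexx _).
  rewrite sin_pihalf expr1n mulr1; apply => x _; first exact: derives_W.
  by rewrite ode.
have := @integrating_factor n (fun x => - W x)
  (fun x => - (P n x * V2 n x - P2 n x * V n x)) t pi t0 tpi (lexx _).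
rewrite sin_pihalf expr1n mulr1 mulNr lerN2; apply => x _.
  by have dW := derives_W x; derive.
by rewrite mulrN mulrN ode.
Qed.

Lemma V_0 : V n 0 = 0.
Proof. by rewrite /Vf ssum0 mul0r mulr0 subr0. Qed.

(** V / P has derivative W / P^2, whose sign is that of W(pi), and it rises from 0 at 0 to pi at
    pi. *)
Let Wpi_gt0 : 0 < W pi.
Proof.
rewrite ltNge; apply/negP => W0.
have : - (V n 0 / P n 0) <= - (V n pi / P n pi).
  apply: (le_of_derive_ge0 (f := fun x => - (V n x / P n x))
    (df := fun x => - (W x / P n x ^+ 2)) (@pi_ge0 R)).
    move=> x xpi; have Px := lt0r_neq0 (P_gt0 xpi).
    have dP := derives_P K n x; have dV := derives_V K n x.
    apply: derives_eq; first by derive.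
    by rewrite /W /=; field.
  move=> x /andP[x0 xpi]; have hx : 0 < x <= pi by rewrite x0 ltW.
  rewrite oppr_ge0 wronskian // -mulrA mulr_le0_ge0 // divr_ge0 ?sqr_ge0 //.
  by rewrite exprn_ge0 // ltW // sin_half_gt0.
have /andP[/lt0r_neq0 Ppi _] := P_pi_bounds nK.
rewrite V_0 mul0r oppr0 V_pi mulfK // oppr_ge0.
by rewrite leNgt pi_gt0.
Qed.

Lemma V_gt0 t : 0 < t <= pi -> 0 < V n t.
Proof.
move=> /andP[t0 tpi].
have : V n 0 / P n 0 < V n t / P n t.
  apply: (lt_of_derive_gt0 (f := fun x => V n x / P n x)
    (df := fun x => W x / P n x ^+ 2) t0).
    move=> x /andP[x0 xt].
    have Px : P n x != 0 by rewrite lt0r_neq0 // P_gt0 // x0 (le_trans xt).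
    have dP := derives_P K n x; have dV := derives_V K n x.
    apply: derives_eq; first by derive.
    by rewrite /W /=; field.
  move=> x /andP[x0 xt]; have xpi := ltW (lt_le_trans xt tpi).
  have hx : 0 < x <= pi by rewrite x0.
  have Px : 0 < P n x by rewrite P_gt0 // xpi ltW.
  by rewrite wronskian // divr_gt0 ?mulr_gt0 ?exprn_gt0 ?sin_half_gt0.
by rewrite V_0 mul0r pmulr_lgt0 // invr_gt0 P_gt0 // ltW.
Qed.

(** As V > 0, the equation makes V' / sin(t/2)^(2n) nondecreasing. If V'(t) <= 0, then V' <= 0 on
    all of (0, t], which contradicts V(t) > V(0) = 0. *)
Lemma V1_gt0 t : 0 < t <= pi -> 0 < V1 n t.
Proof.
move=> /[dup] ht /andP[t0 tpi]; rewrite ltNge; apply/negP => V1t.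
have V1x x : 0 < x -> x <= t -> V1 n x <= 0.
  move=> x0 xt.
  have := @integrating_factor n (V1 n) (V2 n) x t x0 xt tpi (fun y _ => derives_V1 K n y).
  have st : 0 < sin (t / 2) ^+ n.*2 by rewrite exprn_gt0 // sin_half_gt0.
  have sx : 0 <= sin (x / 2) ^+ n.*2.
    by rewrite exprn_ge0 // ltW // sin_half_gt0 // x0 (le_trans xt).
  have hb : forall y, x < y < t -> n%:R * cos (y / 2) * V1 n y <= sin (y / 2) * V2 n y.
    move=> y /andP[xy yt].
    have hy : 0 < y <= pi by rewrite (lt_trans x0 xy) (le_trans (ltW yt)).
    rewrite odeV lerDl mulr_ge0 ?mulr_ge0 // ltW ?sin_half_gt0 ?V_gt0 //.
  move=> /(_ hb) h; rewrite -(pmulr_lle0 _ st); apply: (le_trans h).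
  exact: mulr_le0_ge0.
have : - V n 0 <= - V n t.
  apply: (le_of_derive_ge0 (f := fun x => - V n x) (df := fun x => - V1 n x) (ltW t0)).
    by move=> x _; have dV := derives_V K n x; derive.
  by move=> x /andP[x0 xt]; rewrite oppr_ge0 V1x // ltW.
by rewrite lerN2 V_0 leNgt V_gt0.
Qed.

Lemma V2_gt0 t : 0 < t < pi -> 0 < V2 n t.
Proof.
move=> /andP[t0 tpi]; have ht : 0 < t <= pi by rewrite t0 ltW.
have s0 := sin_half_gt0 ht; rewrite -(pmulr_rgt0 _ s0) odeV.
rewrite ltr_wpDr ?mulr_ge0 ?(ltW (V_gt0 ht)) ?(ltW s0) //.
rewrite !mulr_gt0 ?ltr0n ?V1_gt0 // cos_gt0_pihalf //.
have := @pi_gt0 R; lra.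
Qed.

(** V is strictly convex with V(0) = 0, so V(t) / t increases strictly, up to its value P(pi) at
    pi. *)
Lemma V_lt t : 0 < t < pi -> V n t < t * P n pi.
Proof.
move=> /andP[t0 tpi].
have G x : 0 < x <= pi -> V n x < x * V1 n x.
  move=> /andP[x0 xpi]; rewrite -subr_gt0.
  have : 0 * V1 n 0 - V n 0 < x * V1 n x - V n x.
    apply: (lt_of_derive_gt0 (f := fun x => x * V1 n x - V n x)
      (df := fun x => x * V2 n x) x0).
      move=> y _; have dV := derives_V K n y; have dV1 := derives_V1 K n y.
      by apply: derives_eq; [derive | rewrite /=; ring].
    by move=> y /andP[y0 yx]; rewrite mulr_gt0 // V2_gt0 // y0 (lt_le_trans yx).
  by rewrite mul0r sub0r V_0 oppr0.
have : V n t / t < V n pi / pi.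
  apply: (lt_of_derive_gt0 (f := fun x => V n x / x)
    (df := fun x => (x * V1 n x - V n x) / x ^+ 2) tpi).
    move=> x /andP[tx xpi]; have x0 : x != 0 by rewrite gt_eqF // (lt_le_trans t0).
    have dV := derives_V K n x.
    apply: derives_eq; first by derive.
    by rewrite /=; field.
  move=> x /andP[tx xpi]; have x0 := lt_trans t0 tx.
  by rewrite divr_gt0 ?exprn_gt0 // subr_gt0 G // x0 ltW.
by rewrite V_pi [pi * _]mulrC mulfK ?lt0r_neq0 ?pi_gt0 // ltr_pdivrMr // mulrC.
Qed.

Lemma V_lt_id t : 0 < t < pi -> V n t < t.
Proof.
move=> /[dup] ht /andP[t0 _]; have /andP[_ P1] := P_pi_bounds nK.
by apply: lt_le_trans (V_lt ht) _; rewrite ler_piMr // ltW.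
Qed.

Lemma V_le_P t : 0 <= t <= pi -> V n t <= t * P n t.
Proof.
move=> /andP[t0 tpi]; move: t0; rewrite le_eqVlt => /predU1P[<-|t0].
  by rewrite V_0 mul0r.
move: tpi; rewrite le_eqVlt => /predU1P[->|tpi]; first by rewrite V_pi.
apply: (le_trans (ltW (V_lt _))); first by rewrite t0.
by rewrite ler_pM2l // P_nincr // ltW.
Qed.

End FixedOrder.
End Shape.

(** * Elementary trigonometric inequalities *)

Section TrigBounds.
Variable R : realType.
Implicit Types t x : R.

Lemma half_mul2 t : t = (t / 2) *+ 2.
Proof. by rewrite -mulr_natr; field. Qed.

Lemma sin_double_half t : sin t = 2 * sin (t / 2) * cos (t / 2).
Proof. by rewrite {1}(half_mul2 t) sin_mulr2n; ring. Qed.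

Lemma cos_double_half t : cos t = 1 - 2 * sin (t / 2) ^+ 2.
Proof. by rewrite {1}(half_mul2 t) cos_mulr2n cos2sin2; ring. Qed.

Lemma sin_le_id x : 0 <= x -> sin x <= x.
Proof.
move=> x0; rewrite -subr_ge0.
have := @le_of_derive_ge0 R (fun y => y - sin y) (fun y => 1 - cos y) 0 x x0.
rewrite sin0 subrr; apply => y _; last by rewrite subr_ge0 cos_le1.
have ds := is_derive_sin y; apply: derives_eq; first by derive.
by rewrite /=; ring.
Qed.

Lemma cos_ge_quadratic x : 0 <= x -> 0 <= cos x - 1 + x ^+ 2 / 2.
Proof.
move=> x0.
have := @le_of_derive_ge0 R (fun y => cos y - 1 + y ^+ 2 / 2) (fun y => y - sin y) 0 x x0.
rewrite cos0 subrr expr0n mul0r add0r; apply => y.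
  by move=> _; apply: derives_eq; [derive | rewrite /=; field].
by move=> /andP[y0 _]; rewrite subr_ge0 sin_le_id // ltW.
Qed.

Lemma sin_ge_cubic x : 0 <= x -> 0 <= sin x - x + x ^+ 3 / 6.
Proof.
move=> x0.
have := @le_of_derive_ge0 R (fun y => sin y - y + y ^+ 3 / 6)
  (fun y => cos y - 1 + y ^+ 2 / 2) 0 x x0.
rewrite sin0 subrr expr0n mul0r add0r; apply => y.
  by move=> _; apply: derives_eq; [derive | rewrite /=; field].
by move=> /andP[y0 _]; rewrite cos_ge_quadratic // ltW.
Qed.

Lemma cos_le_quartic x : 0 <= x -> cos x <= 1 - x ^+ 2 / 2 + x ^+ 4 / 24.
Proof.
move=> x0; rewrite -subr_ge0.
have := @le_of_derive_ge0 R (fun y => 1 - y ^+ 2 / 2 + y ^+ 4 / 24 - cos y)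
  (fun y => sin y - y + y ^+ 3 / 6) 0 x x0.
rewrite cos0 !expr0n !mul0r subr0 addr0 subrr; apply => y.
  by move=> _; apply: derives_eq; [derive | rewrite /=; field].
by move=> /andP[y0 _]; rewrite sin_ge_cubic // ltW.
Qed.

(** The quartic bound is taken at pi/2, where the cosine vanishes; pi/2 < 2 excludes the larger root
    of the resulting quadratic in (pi/2)^2. *)
Lemma pi2_le12 : pi ^+ 2 <= 12 :> R.
Proof.
have /andP[h0 h2] := pihalf_02 R.
have := cos_le_quartic (ltW h0); rewrite cos_pihalf.
set x := pi / 2 in h0 h2 *; rewrite (_ : pi = 2 * x); last by rewrite /x; field.
rewrite (_ : x ^+ 4 = x ^+ 2 ^+ 2); last by rewrite -exprM.
rewrite (_ : (2 * x) ^+ 2 = 4 * x ^+ 2); last by ring.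
have : x ^+ 2 < 4 by rewrite expr2; nra.
move: (x ^+ 2) => y y4; nra.
Qed.

Lemma cos_half_ge_linear t : 0 <= t <= pi -> 1 - t / pi <= cos (t / 2).
Proof.
move=> ht; rewrite -subr_ge0.
have pi0 := @pi_gt0 R.
apply: (@concave_ge0 R (fun t => cos (t / 2) - (1 - t / pi))
  (fun t => pi^-1 - sin (t / 2) / 2) pi _ _ _ _ t ht).
- move=> x _; apply: derives_eq; first by derive.
  by rewrite /=; move: pi^-1 => q; field.
- move=> x y x0 xy ypi; rewrite lerB // ler_pM2r ?invr_gt0 //.
  move: xy; rewrite le_eqVlt => /predU1P[-> //|xy].
  by rewrite ltW // ltr_sin ?in_itv /= ?ltr_pM2r ?invr_gt0 //; lra.
- by rewrite /= !mul0r cos0; ring.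
- by rewrite /= cos_pihalf mulfV ?lt0r_neq0 //; ring.
Qed.

End TrigBounds.

(** * Bounds on the symbols *)

Section SymbolBounds.
Variables (R : realType) (K : nat).
Implicit Types (n k : nat) (t x : R).

Local Notation P := (@Pf R K).
Local Notation V := (@Vf R K).
Local Notation V1 := (@V1f R K).
Local Notation rho := (@rhof R K).
Local Notation F := (@Ff R K).
Local Notation v := (@vf R K).
Local Notation E := (@Ef R K).
Local Notation Psi := (@Psif R K).

Lemma F_0 n : F n 0 = 0. Proof. by rewrite /Ff subrr mulr0. Qed.

Lemma Psi_0 n : Psi n 0 = 0. Proof. by rewrite /Psif F_0 mul0r subrr. Qed.

Lemma rho_pi n : rho n pi = 0. Proof. by rewrite /rhof ssumpi mulr0. Qed.
Lemma E_0 n : E n 0 = 0. Proof. by rewrite /Ef ssum0 mulr0. Qed.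
Lemma E_pi n : E n pi = 0. Proof. by rewrite /Ef ssumpi mulr0. Qed.

Lemma derives_Psi n t : derives (Psi n) t (2 * t - 2 * V n t).
Proof.
have dF := derives_F K n t; have dr := derives_rho K n t.
by apply: derives_eq; [derive | rewrite /=; ring].
Qed.

(** By [v_succ], v is built up from v = 0 at index 0 by adding positive multiples of P. *)
Lemma v_gt0 n t : (0 < n)%N -> (uphalf n < K)%N -> 0 <= t <= pi -> 0 < v n t.
Proof.
move=> + + ht; elim: n => // n ih _ nK; rewrite v_succ //.
have Pp := P_gt0 nK ht.
apply: ltr_wpDl; last by rewrite divr_gt0 ?mulr_gt0 ?exprn_gt0 ?ltr0n.
case: n ih nK Pp => [|n] ih nK _; first by rewrite v0.
by rewrite ltW // ih // uphalf_ltW.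
Qed.

Lemma Psi_incr n t : (uphalf n.+1 < K)%N -> 0 <= t <= pi -> Psi n t <= Psi n.+1 t.
Proof.
move=> nK /andP[t0 tpi]; rewrite Psi_succ // lerDl.
move: t0; rewrite le_eqVlt => /predU1P[<-|t0]; first by rewrite V1_0 // mulr0 mul0r.
by rewrite divr_ge0 ?mulr_ge0 // ltW // V1_gt0 // t0.
Qed.

Lemma rho_incr n t : (uphalf n.+1 < K)%N -> 0 <= t <= pi -> rho n t <= rho n.+1 t.
Proof.
move=> nK /andP[t0 tpi]; rewrite rho_succ lerDl oppr_ge0 mulr_le0_ge0 ?invr_ge0 ?exprn_ge0 //.
move: t0; rewrite le_eqVlt => /predU1P[<-|t0]; first by rewrite /P1f ssum0 !mulr0.
by rewrite pmulr_rle0 // P1_le0 // t0.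
Qed.

Lemma Psi_le_mono m n t : (m <= n)%N -> (uphalf n < K)%N -> 0 <= t <= pi -> Psi m t <= Psi n t.
Proof.
move=> + + ht; elim: n => [|n ih]; first by rewrite leqn0 => /eqP->.
rewrite leq_eqVlt => /predU1P[-> //|]; rewrite ltnS => mn nK.
by apply: le_trans (Psi_incr nK ht); apply: ih => //; apply: uphalf_ltW.
Qed.

Lemma rho_le_mono m n t : (m <= n)%N -> (uphalf n < K)%N -> 0 <= t <= pi -> rho m t <= rho n t.
Proof.
move=> + + ht; elim: n => [|n ih]; first by rewrite leqn0 => /eqP->.
rewrite leq_eqVlt => /predU1P[-> //|]; rewrite ltnS => mn nK.
by apply: le_trans (rho_incr nK ht); apply: ih => //; apply: uphalf_ltW.
Qed.

(** The left side is (8 sin(t/2) - sin t) / 3, which matches t up to O(t^5); the derivative of the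
    difference is a multiple of the square (1 - cos(t/2))^2. *)
Lemma kap_le_id t : 0 <= t -> 2 / 3 * sin (t / 2) * (4 - cos (t / 2)) <= t.
Proof.
move=> t0; rewrite -subr_ge0.
have := @le_of_derive_ge0 R (fun x => x - 2 / 3 * sin (x / 2) * (4 - cos (x / 2)))
  (fun x => 2 / 3 * (1 - cos (x / 2)) ^+ 2) 0 t t0.
rewrite mul0r sin0 mulr0 mul0r subrr; apply => x _; last first.
  by rewrite mulr_ge0 ?sqr_ge0 ?divr_ge0.
apply: derives_eq; first by derive.
rewrite /=; have := cos2Dsin2 (x / 2).
move: (cos (x / 2)) (sin (x / 2)) => c s cs; apply: subr0_eq.
rewrite [LHS](_ : _ = - (c ^+ 2 + s ^+ 2 - 1) / 3); last by field.
by rewrite cs subrr oppr0 mul0r.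
Qed.

Section FixedOrder.
Variable n : nat.
Hypotheses (n0 : (0 < n)%N) (nK : (uphalf n < K)%N).

Let K1 : (1 < K)%N.
Proof. by apply: leq_ltn_trans nK; case: (n) n0. Qed.

(** rho' = 2 P - 2 is nonincreasing, so rho is concave, and it vanishes at 0 and pi. *)
Lemma rho_ge0 t : 0 <= t <= pi -> 0 <= rho n t.
Proof.
apply: (concave_ge0 (df := fun x => 2 * P n x - 2)).
- by move=> x _; exact: derives_rho.
- by move=> x y x0 xy ypi; rewrite lerB // ler_pM2l // P_nincr.
- by rewrite /rhof ssum0 mulr0.
- exact: rho_pi.
Qed.

Lemma Psi_gt0 t : 0 < t <= pi -> 0 < Psi n t.
Proof.
move=> /andP[t0 tpi]; rewrite -(Psi_0 n).
apply: (lt_of_derive_gt0 (df := fun x => 2 * x - 2 * V n x) t0).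
  by move=> x _; exact: derives_Psi.
move=> x /andP[x0 xt]; rewrite subr_gt0 ltr_pM2l // V_lt_id // x0.
exact: lt_le_trans tpi.
Qed.

Lemma Psi_ge0 t : 0 <= t <= pi -> 0 <= Psi n t.
Proof.
move=> /andP[]; rewrite le_eqVlt => /predU1P[<- _|t0 tpi]; first by rewrite Psi_0.
by rewrite ltW // Psi_gt0 // t0.
Qed.

Lemma Psi_le t : 0 <= t <= pi -> Psi n t <= t ^+ 2.
Proof.
move=> /andP[t0 tpi]; rewrite -subr_ge0.
have := @le_of_derive_ge0 R (fun x => x ^+ 2 - Psi n x) (fun x => 2 * V n x) 0 t t0.
rewrite Psi_0 subr0 expr0n; apply => x.
  by move=> _; have dP := derives_Psi n x; apply: derives_eq; [derive | rewrite /=; ring].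
by move=> /andP[x0 xt]; rewrite mulr_ge0 // ltW // V_gt0 // x0 (le_trans (ltW xt)).
Qed.

Lemma F_gt0 t : 0 < t <= pi -> 0 < F n t.
Proof.
move=> /[dup] ht /andP[t0 tpi]; have := Psi_gt0 ht.
have h : 0 <= t * rho n t by rewrite mulr_ge0 ?rho_ge0 // ltW.
rewrite /Psif; lra.
Qed.

Lemma derives_Omega t : derives (fun t => t * v n t - E n t) t (3 * Psi n t).
Proof.
have dv := derives_v K n t; have dE := derives_E K n t.
by apply: derives_eq; [derive | rewrite /Psif /=; ring].
Qed.

Lemma E_le t : 0 <= t <= pi -> E n t <= t * v n t.
Proof.
move=> /andP[t0 tpi]; rewrite -subr_ge0.
have := @le_of_derive_ge0 R _ _ 0 t t0 (fun x _ => derives_Omega x).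
rewrite mul0r E_0 subr0; apply => x /andP[x0 xt].
by rewrite mulr_ge0 // Psi_ge0 // ltW //= (le_trans (ltW xt)).
Qed.

(** Since Psi <= t^2, the function t^3 - (t v - E) is nondecreasing; it is 0 at 0, and E(pi) = 0. *)
Lemma v_pi_le : v n pi <= pi ^+ 2.
Proof.
have := @le_of_derive_ge0 R (fun x => x ^+ 3 - (x * v n x - E n x))
  (fun x => 3 * x ^+ 2 - 3 * Psi n x) 0 pi (@pi_ge0 R).
rewrite mul0r E_0 E_pi expr0n !subr0 => h.
have pi0 := @pi_gt0 R.
rewrite -(ler_pM2l pi0) -exprS -subr_ge0; apply: h => x.
  move=> _; have dO := derives_Omega x.
  by apply: derives_eq; [derive | rewrite /=; ring].
by move=> /andP[x0 xpi]; rewrite -mulrBr mulr_ge0 // subr_ge0 Psi_le // !ltW.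
Qed.

Lemma rho_le t : 0 <= t <= pi -> rho n t <= 2 * (pi - t).
Proof.
move=> /andP[t0 tpi].
have := @le_of_derive_ge0 R (fun x => rho n x + 2 * x) (fun x => 2 * P n x) t pi tpi.
rewrite rho_pi add0r => h; rewrite mulrBr lerBrDr; apply: h => x.
  move=> _; have dr := derives_rho K n x.
  by apply: derives_eq; [derive | rewrite /=; ring].
move=> /andP[tx xpi]; rewrite mulr_ge0 // ltW // P_gt0 //.
by rewrite (le_trans t0) ltW.
Qed.

(* As n tends to infinity, v tends to pi^2 + 3 (pi - t)^2. *)
Lemma v_le t : 0 <= t <= pi -> v n t <= pi ^+ 2 + 3 * (pi - t) ^+ 2.
Proof.
move=> /andP[t0 tpi].
have := @le_of_derive_ge0 R (fun x => v n x - 3 * (pi - x) ^+ 2)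
  (fun x => 6 * (pi - x) - 3 * rho n x) t pi tpi.
rewrite subrr expr0n mulr0 subr0 => h.
rewrite -lerBlDr; apply: le_trans v_pi_le; apply: h => x.
  move=> _; have dv := derives_v K n x.
  apply: derives_eq; [derive | rewrite /=].
  by move: pi => q; ring.
move=> /andP[tx xpi]; have := @rho_le x; rewrite (le_trans t0 (ltW tx)) (ltW xpi).
by move=> /(_ isT) hr; rewrite subr_ge0; lra.
Qed.

(** With w = 1 - t / pi the bound [v_le] is pi^2 (1 + 3 w^2). Then pi^2 <= 12, 1 + 3 w^2 <= (1 +
    w)^2 for 0 <= w <= 1, and w <= cos(t/2) give the form used with sin(t/2) and cos(t/2). *)
Lemma v_le_cos t : 0 <= t <= pi -> v n t <= 12 * (1 + cos (t / 2)) ^+ 2.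
Proof.
move=> ht; apply: le_trans (v_le ht) _; have /andP[t0 tpi] := ht.
have pi0 := @pi_gt0 R; have p12 := pi2_le12 R.
have hc := cos_half_ge_linear ht; move: hc.
pose w : R := 1 - t / pi; rewrite -/w => hc.
have w0 : 0 <= w by rewrite subr_ge0 ler_pdivrMr // mul1r.
have w1 : w <= 1 by rewrite lerBlDr lerDl divr_ge0 // ltW.
have e : pi - t = pi * w by rewrite /w mulrBr mulr1 mulrCA mulfV ?lt0r_neq0 // mulr1.
rewrite {}e exprMn; clearbody w.
have h1 : 12 * (1 + w) ^+ 2 <= 12 * (1 + cos (t / 2)) ^+ 2.
  by rewrite ler_pM2l // lerXn2r ?nnegrE ?lerD2l // addr_ge0 // (le_trans w0).
apply: le_trans h1.
have h2 : 0 <= w * (1 - w) by rewrite mulr_ge0 // subr_ge0.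
have h3 : pi ^+ 2 * (1 + 3 * w ^+ 2) <= 12 * (1 + 3 * w ^+ 2).
  by rewrite ler_pM2r // ltr_wpDr // mulr_ge0 // sqr_ge0.
apply: le_trans (_ : pi ^+ 2 * (1 + 3 * w ^+ 2) <= _); first by rewrite mulrDr mulr1 mulrCA.
apply: le_trans h3 _; rewrite ler_pM2l // -subr_ge0.
rewrite [X in 0 <= X](_ : _ = 2 * (w * (1 - w))); last by ring.
by rewrite mulr_ge0.
Qed.

(** E is concave, as E'' = - 6 rho - 6 (t P - V), and vanishes at both ends. *)
Lemma E_ge0 t : 0 <= t <= pi -> 0 <= E n t.
Proof.
apply: (concave_ge0 (df := fun x => v n x - 3 * F n x)).
- by move=> x _; exact: derives_E.
- move=> x y x0 xy ypi; rewrite -lerN2.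
  apply: (le_of_derive_ge0 (f := fun x => - (v n x - 3 * F n x))
    (df := fun x => 6 * rho n x + 6 * (x * P n x - V n x)) xy).
    move=> z _; have dv := derives_v K n z; have dF := derives_F K n z.
    by apply: derives_eq; [derive | rewrite /=; ring].
  move=> z /andP[xz zy].
  have hz : 0 <= z <= pi by rewrite (le_trans x0 (ltW xz)) (le_trans (ltW zy)).
  apply: addr_ge0; first by rewrite mulr_ge0 // rho_ge0.
  by rewrite mulr_ge0 // subr_ge0 V_le_P.
- exact: E_0.
- exact: E_pi.
Qed.

Lemma Psi_ge_sin t : 0 <= t <= pi -> 4 * sin (t / 2) ^+ 2 <= Psi n t.
Proof.
move=> ht; apply: le_trans (Psi_le_mono n0 nK ht).
by rewrite Psi1 // cos_double_half [leLHS](_ : _ = 2 * (1 - (1 - 2 * sin (t / 2) ^+ 2))) //; ring.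
Qed.

(* If kap <= t and kap' = 1 - d, then (kap v - E)' = 3 (F - kap rho) - d v,
   where F - kap rho >= Psi. *)
Lemma E_le_tau t (tau := 2 * sin (t / 2)) : 0 <= t <= pi ->
  E n t <= tau * (v n t + tau ^+ 2).
Proof.
move=> /andP[t0 tpi]; rewrite -subr_ge0 /tau.
have := @le_of_derive_ge0 R
  (fun x => 2 * sin (x / 2) * (v n x + (2 * sin (x / 2)) ^+ 2) - E n x)
  (fun x => 3 * (F n x - 2 * sin (x / 2) * rho n x)
    + 12 * sin (x / 2) ^+ 2 * cos (x / 2) - (1 - cos (x / 2)) * v n x) 0 t t0.
rewrite mul0r sin0 mulr0 mul0r E_0 subrr; apply => x.
  move=> _; have dv := derives_v K n x; have dE := derives_E K n x.
  by apply: derives_eq; [derive | rewrite /=; field].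
move=> /andP[x0 xt]; have hx : 0 <= x <= pi by rewrite ltW //= (le_trans (ltW xt)).
have hs : 2 * sin (x / 2) <= x.
  by have := @sin_le_id R (x / 2); lra.
have hr : 2 * sin (x / 2) * rho n x <= x * rho n x by rewrite ler_wpM2r // rho_ge0.
have hP := Psi_ge_sin hx; have hv := v_le_cos hx.
have c0 := cos_half_ge0 hx; have c1 := cos_le1 (x / 2).
have es := sin2cos2 (x / 2).
move: hP hr; rewrite /Psif es.
set c := cos (x / 2) in hv c0 c1 es *; set s := sin (x / 2) => hP hr.
have hvc : (1 - c) * v n x <= (1 - c) * (12 * (1 + c) ^+ 2).
  by rewrite ler_wpM2l // subr_ge0.
(* The bounds on Psi and v balance exactly: both sides equal 12 (1 - c) (1 + c)^2. *)
have : 0 <= 3 * (4 * (1 - c ^+ 2)) + 12 * (1 - c ^+ 2) * c - (1 - c) * (12 * (1 + c) ^+ 2).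
  by rewrite le_eqVlt eq_sym; apply/orP; left; apply/eqP; ring.
lra.
Qed.

(** The scheme of [E_le_tau] with d = (2/3) (1 - cos(t/2))^2, small enough that the lower bound on
    Psi absorbs d v without a cubic correction. *)
Lemma E_le_kap t (kap := 2 / 3 * sin (t / 2) * (4 - cos (t / 2))) : 0 <= t <= pi ->
  E n t <= kap * v n t.
Proof.
move=> /andP[t0 tpi]; rewrite -subr_ge0 /kap.
have := @le_of_derive_ge0 R
  (fun x => 2 / 3 * sin (x / 2) * (4 - cos (x / 2)) * v n x - E n x)
  (fun x => 3 * (F n x - 2 / 3 * sin (x / 2) * (4 - cos (x / 2)) * rho n x)
    - 2 / 3 * (1 - cos (x / 2)) ^+ 2 * v n x) 0 t t0.
rewrite mul0r sin0 mulr0 !mul0r E_0 subrr; apply => x.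
  move=> _; have dv := derives_v K n x; have dE := derives_E K n x.
  apply: derives_eq; first by derive.
  rewrite /=; have := cos2Dsin2 (x / 2).
  move: (cos (x / 2)) (sin (x / 2)) => c s cs; apply: subr0_eq.
  rewrite [LHS](_ : _ = (c ^+ 2 + s ^+ 2 - 1) * v n x / 3); last by field.
  by rewrite cs subrr !mul0r.
move=> /andP[x0 xt]; have hx : 0 <= x <= pi by rewrite ltW //= (le_trans (ltW xt)).
have hk : 2 / 3 * sin (x / 2) * (4 - cos (x / 2)) * rho n x <= x * rho n x.
  by rewrite ler_wpM2r ?rho_ge0 // kap_le_id // ltW.
have hP := Psi_ge_sin hx; have hv := v_le_cos hx.
have c0 := cos_half_ge0 hx; have c1 := cos_le1 (x / 2).
move: hP hk; rewrite /Psif sin2cos2.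
set c := cos (x / 2) in hv c0 c1 *; set k := 2 / 3 * _ * _ * rho n x => hP hk.
have hvc : (1 - c) ^+ 2 * v n x <= (1 - c) ^+ 2 * (12 * (1 + c) ^+ 2).
  by rewrite ler_wpM2l // sqr_ge0.
have hc : 0 <= (1 - c ^+ 2) * (4 + 8 * c ^+ 2).
  apply: mulr_ge0; first by rewrite subr_ge0 expr_le1.
  by rewrite addr_ge0 // mulr_ge0 // sqr_ge0.
have -> : 3 * (F n x - k) - 2 / 3 * (1 - c) ^+ 2 * v n x =
  3 * (F n x - k) - 2 / 3 * ((1 - c) ^+ 2 * v n x) by ring.
have e : 3 * (4 * (1 - c ^+ 2)) - 2 / 3 * ((1 - c) ^+ 2 * (12 * (1 + c) ^+ 2)) =
  (1 - c ^+ 2) * (4 + 8 * c ^+ 2) by field.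
lra.
Qed.

End FixedOrder.
End SymbolBounds.

(** * Stability of a single Fourier mode *)

Section ModeStability.
Variable R : realType.

(* f - y s - s^2 is concave in s and nonnegative at s = rho f / u - y and at
   s = e / w, hence at their barycentre with weights u and w. *)
Lemma concave_barycentre (u w f y rho e : R) (X := e + rho * f - u * y) :
  0 < u -> 0 < w -> 0 <= f -> 0 <= u ^+ 2 + rho * y * u - rho ^+ 2 * f ->
  e ^+ 2 + y * e * w <= f * w ^+ 2 ->
  0 <= (u + w) ^+ 2 * f - (u + w) * y * X - X ^+ 2.
Proof.
move=> u0 w0 f0; rewrite /X -(subr_ge0 (_ + _)).
set A := _ - _ => A0; set B := _ - _ => B0.
rewrite [X in 0 <= X](_ : _ = f * A * (1 + w / u) + B * (1 + u / w)
  + u * w * ((rho * f - u * y) / u - e / w) ^+ 2).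
  have uw0 : 0 <= u / w by rewrite divr_ge0 // ltW.
  have wu0 : 0 <= w / u by rewrite divr_ge0 // ltW.
  apply: addr_ge0; last by rewrite mulr_ge0 ?sqr_ge0 // mulr_ge0 // ltW.
  apply: addr_ge0; apply: mulr_ge0 => //; last by rewrite addr_ge0.
    exact: mulr_ge0.
  by rewrite addr_ge0.
by rewrite /A /B; field; rewrite !lt0r_neq0.
Qed.

(* The two equations say that x + i y is a root of
   z^2 + (p1 + i q1) z + (p2 + i q2). *)
Lemma routh_hurwitz2 (p1 q1 p2 q2 x y : R) :
  0 < p1 -> 0 < p1 ^+ 2 * p2 + p1 * q1 * q2 - q2 ^+ 2 ->
  x ^+ 2 - y ^+ 2 + p1 * x - q1 * y + p2 = 0 ->
  2 * x * y + p1 * y + q1 * x + q2 = 0 -> x < 0.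
Proof.
move=> p0 D0 re im; rewrite ltNge; apply/negP => x0.
have q0 : 0 < 4 * p2 + q1 ^+ 2.
  have h : 0 < p1 ^+ 2 * (4 * p2 + q1 ^+ 2).
    have -> : p1 ^+ 2 * (4 * p2 + q1 ^+ 2) =
      4 * (p1 ^+ 2 * p2 + p1 * q1 * q2 - q2 ^+ 2) + (2 * q2 - p1 * q1) ^+ 2 by ring.
    by rewrite ltr_wpDr ?sqr_ge0 // mulr_gt0.
  by move: h; rewrite pmulr_rgt0 ?exprn_gt0.
(* This quantity arises by eliminating y from the two equations, so it vanishes at a root, yet all
   its terms are nonnegative when x >= 0 and the first is positive. *)
have : 0 < (p1 ^+ 2 * p2 + p1 * q1 * q2 - q2 ^+ 2)
  + (x ^+ 2 + p1 * x) * (2 * x + p1) ^+ 2 + (4 * p2 + q1 ^+ 2) * (x ^+ 2 + p1 * x).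
  have h : 0 <= x ^+ 2 + p1 * x by rewrite addr_ge0 ?sqr_ge0 // mulr_ge0 // ltW.
  apply: ltr_wpDr; first by rewrite mulr_ge0 // ltW.
  by apply: ltr_wpDr => //; rewrite mulr_ge0 // sqr_ge0.
rewrite (_ : _ + _ = (x ^+ 2 - y ^+ 2 + p1 * x - q1 * y + p2) * (2 * x + p1) ^+ 2
  + (2 * x * y + p1 * y + q1 * x + q2) * (y * (2 * x + p1) - (q1 * x + q2) + q1 * (2 * x + p1))).
  by rewrite re im !mul0r addr0 ltxx.
ring.
Qed.

Variable K : nat.
Local Notation rho := (@rhof R K).
Local Notation F := (@Ff R K).
Local Notation v := (@vf R K).
Local Notation E := (@Ef R K).

Lemma F_lower_tau n t (tau := 2 * sin (t / 2)) :
  (0 < n)%N -> (uphalf n < K)%N -> 0 <= t <= pi ->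
  tau ^+ 2 + rho n t * tau <= F n t.
Proof.
move=> n0 nK ht; have hP := Psi_ge_sin n0 nK ht.
have ht2 : tau <= t by have := @sin_le_id R (t / 2); rewrite /tau; lra.
have : rho n t * tau <= rho n t * t by rewrite ler_wpM2l // rho_ge0.
move: hP; rewrite /Psif (_ : 4 * _ = tau ^+ 2); last by rewrite /tau; ring.
lra.
Qed.

(** With E <= t v the claim reduces to t rho < F, that is, Psi > 0. *)
Lemma mode_diffusion p q t : (0 < p)%N -> (0 < q)%N -> (uphalf p < K)%N ->
  (uphalf q < K)%N -> 0 < t <= pi -> rho p t * E q t < F p t * v q t.
Proof.
move=> p0 q0 pK qK /[dup] ht /andP[t0 tpi].
have ht' : 0 <= t <= pi by rewrite ltW.
apply: (@le_lt_trans _ _ (rho p t * (t * v q t))).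
  by rewrite ler_wpM2l ?rho_ge0 // E_le.
rewrite mulrCA mulrA ltr_pM2r ?v_gt0 //.
by have := Psi_gt0 p0 pK ht; rewrite /Psif subr_gt0.
Qed.

Lemma mode_convection p q r t (X := E q t + rho p t * F r t - F p t * rho r t) :
  (0 < p)%N -> (0 < q)%N -> (0 < r)%N -> (uphalf p < K)%N ->
  (uphalf q < K)%N -> (uphalf r < K)%N -> 0 < t <= pi ->
  0 <= (F p t + v q t) ^+ 2 * F r t - (F p t + v q t) * rho r t * X - X ^+ 2.
Proof.
move=> p0 q0 r0 pK qK rK /[dup] ht /andP[t0 tpi].
have ht' : 0 <= t <= pi by rewrite ltW.
have u0 := F_gt0 p0 pK ht; have w0 := v_gt0 q0 qK ht'; have f0 := F_gt0 r0 rK ht.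
have s0 := sin_half_gt0 ht.
have E0 := E_ge0 q0 qK ht'; have rho0 := rho_ge0 pK ht'.
(* For index 1, rho is 0 and F is tau^2, so the claim is X <= (F + v) tau: the sum of [E_le_tau] and
   tau times [F_lower_tau]. *)
have [r1|r2] : r = 1 \/ (2 <= r)%N by case: r r0 {X rK f0} => [|[|r]]; [|left|right].
  have K1 : (1 < K)%N by move: rK; rewrite r1.
  have hE := E_le_tau q0 qK ht'; have hF := F_lower_tau p0 pK ht'.
  have fE : F r t = (2 * sin (t / 2)) ^+ 2.
    have := Psi1 t K1; rewrite /Psif r1 rho1 mulr0 subr0 => ->.
    by rewrite cos_double_half; ring.
  have yE : rho r t = 0 by rewrite r1 rho1.
  move: hE hF; rewrite /X fE yE !(mulr0, mul0r, subr0).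
  set tau := 2 * sin (t / 2) => hE hF.
  have tau0 : 0 <= tau by rewrite mulr_ge0 // ltW.
  have X0 : 0 <= E q t + rho p t * tau ^+ 2 by rewrite addr_ge0 // mulr_ge0 // sqr_ge0.
  have T0 : 0 <= (F p t + v q t) * tau by rewrite mulr_ge0 // ltW // addr_gt0.
  rewrite -exprMn subr_ge0 lerXn2r ?nnegrE //.
  have : tau * (tau ^+ 2 + rho p t * tau) <= tau * F p t by rewrite ler_wpM2l.
  lra.
have K1 : (1 < K)%N by apply: leq_ltn_trans rK; exact: (uphalf_leq r2).
have y0 := rho_ge0 rK ht'.
apply: concave_barycentre => //; first exact: ltW.
  (* First point of the barycentre: t rho <= u, while Psi <= t^2 bounds f by t^2 + t y. *)
  have h1 : rho p t * t <= F p t.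
    by have := Psi_gt0 p0 pK ht; rewrite /Psif; lra.
  have h2 : F r t <= t ^+ 2 + t * rho r t.
    by have := Psi_le rK ht'; rewrite /Psif; lra.
  have h3 : rho p t ^+ 2 * F r t <= rho p t ^+ 2 * (t ^+ 2 + t * rho r t).
    by rewrite ler_wpM2l // sqr_ge0.
  have h0 : 0 <= rho p t * t by rewrite mulr_ge0 // ltW.
  have h4 : (rho p t * t) ^+ 2 <= F p t ^+ 2.
    by rewrite lerXn2r // nnegrE ltW.
  have h5 : rho p t * rho r t * (rho p t * t) <= rho p t * rho r t * F p t.
    by rewrite ler_wpM2l // mulr_ge0.
  rewrite subr_ge0; apply: (le_trans h3); apply: le_trans (lerD h4 h5).
  by rewrite le_eqVlt; apply/orP; left; apply/eqP; ring.
(* Second point: as E <= kap v, it suffices that kap^2 + y kap <= f. *)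
have hk := E_le_kap q0 qK ht'; have hkt := kap_le_id (ltW t0).
have hP : 4 * (1 - cos t) - t * sin t <= Psif K r t.
  by rewrite -(Psi2 _ K1); exact: Psi_le_mono.
have hr : sin t <= rho r t by rewrite -(rho2 _ K1); exact: rho_le_mono.
move: hk hkt hP; rewrite /Psif; set kap := 2 / 3 * _ * _ => hk hkt hP.
have k0 : 0 <= kap.
  apply: mulr_ge0; first by rewrite mulr_ge0 ?divr_ge0 // ltW.
  by have := cos_le1 (t / 2); lra.
(* At index 2 the defect is (8/9) sin(t/2)^2 (1 - cos(t/2))^2. Larger indices follow because f - kap
   y = Psi + (t - kap) y grows with Psi and y. *)
have hf : kap ^+ 2 + rho r t * kap <= F r t.
  have h1 : (t - kap) * sin t <= (t - kap) * rho r t by rewrite ler_wpM2l // subr_ge0.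
  have h2 : 0 <= 4 * (1 - cos t) - kap * sin t - kap ^+ 2.
    rewrite sin_double_half cos_double_half.
    rewrite [X in 0 <= X](_ : _ = 8 / 9 * sin (t / 2) ^+ 2 * (1 - cos (t / 2)) ^+ 2).
      by apply: mulr_ge0; rewrite ?sqr_ge0 // mulr_ge0 ?sqr_ge0 // divr_ge0.
    by rewrite /kap; field.
  lra.
apply: (@le_trans _ _ ((kap * v q t) ^+ 2 + rho r t * (kap * v q t) * v q t)).
  apply: lerD; first by rewrite lerXn2r ?nnegrE // mulr_ge0 // ltW.
  by apply: ler_wpM2r; [exact: ltW | exact: ler_wpM2l].
rewrite [leLHS](_ : _ = (kap ^+ 2 + rho r t * kap) * v q t ^+ 2); last by ring.
by rewrite ler_wpM2r ?sqr_ge0.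
Qed.

Lemma mode_stable p q r t Pe x y : (0 < p)%N -> (0 < q)%N -> (0 < r)%N -> (uphalf p < K)%N ->
  (uphalf q < K)%N -> (uphalf r < K)%N -> 0 < t <= pi ->
  let X := E q t + rho p t * F r t - F p t * rho r t in
  let p1 := F p t + v q t in let q1 := - Pe * rho r t in
  let p2 := F p t * v q t - rho p t * E q t + Pe ^+ 2 * F r t in let q2 := Pe * X in
  x ^+ 2 - y ^+ 2 + p1 * x - q1 * y + p2 = 0 ->
  2 * x * y + p1 * y + q1 * x + q2 = 0 -> x < 0.
Proof.
move=> p0 q0 r0 pK qK rK /[dup] ht /andP[t0 tpi] X p1 q1 p2 q2.
have hp1 : 0 < p1.
  by rewrite addr_gt0 ?F_gt0 ?v_gt0 // ltW.
apply: routh_hurwitz2 => //.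
have h1 := mode_diffusion p0 q0 pK qK ht.
have h2 := mode_convection p0 q0 r0 pK qK rK ht; rewrite -/X -/p1 in h2.
(* The Routh-Hurwitz quantity has only two powers of Pe: a constant term, positive by diffusion, and
   a Pe^2 term, nonnegative by [mode_convection]. *)
rewrite [X in 0 < X](_ : _ = p1 ^+ 2 * (F p t * v q t - rho p t * E q t) +
  Pe ^+ 2 * (p1 ^+ 2 * F r t - p1 * rho r t * X - X ^+ 2)); last first.
  by rewrite /q1 /p2 /q2; ring.
apply: ltr_wpDr; first by rewrite mulr_ge0 // sqr_ge0.
by rewrite mulr_gt0 ?exprn_gt0 ?subr_gt0.
Qed.

End ModeStability.

(** * Comparison with the explicit coefficients *)

Section CoefficientFormulas.
Variable R : realType.
Implicit Types n k K p : nat.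

Local Notation phi := (@phi R).
Local Notation psi := (@psi R).

Lemma stencil_split (p p' : nat) : (p.-1 <= p' <= p)%N ->
  uphalf (p + p') = p /\ (p + p')./2 = p'.
Proof.
move=> /andP[h1 h2]; have [->|e] : p = p' \/ p = p'.+1 by lia.
  by rewrite addnn uphalf_double doubleK.
by rewrite e addSn addnn /= uphalf_double doubleK.
Qed.

Lemma Ccoef_nat l r k : (k <= r)%N ->
  Ccoef R l r k = (l`!)%:R * (r`!)%:R / (((l + k)`!)%:R * ((r - k)`!)%:R).
Proof. by move=> kr; rewrite /Ccoef subzn // -PoszD. Qed.

Lemma CcoefN p k : (k <= p)%N -> Ccoef R p p (- k%:Z) = Ccoef R p p k.
Proof. by move=> kp; rewrite /Ccoef opprK subzn // [X in _ / X = _]mulrC. Qed.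

Lemma fact_neq0 k : (k`!)%:R != 0 :> R.
Proof. by rewrite pnatr_eq0 -lt0n fact_gt0. Qed.

Lemma Ccoef0 p : Ccoef R p p 0%N = 1.
Proof. by rewrite Ccoef_nat // addn0 subn0 mulfV // mulf_neq0 ?fact_neq0. Qed.

Lemma CcoefS p k : (k < p)%N ->
  (p%:R + k.+1%:R) * Ccoef R p p k.+1 = (p%:R - k%:R) * Ccoef R p p k.
Proof.
move=> kp; rewrite !Ccoef_nat ?(ltnW kp) // addnS factS -natrD addnS.
rewrite -(natrB _ (ltnW kp)) subnS; case: (p - k)%N (subn_gt0 k p) => [|m].
  by rewrite kp.
move=> _; rewrite factS /= !natrM; field.
by rewrite !fact_neq0 -natrD !nat1r !pnatr_eq0.
Qed.

Lemma harmonic_numberS k : harmonic_number R k.+1 = harmonic_number R k + k.+1%:R^-1.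
Proof. by rewrite /harmonic_number big_nat_recr. Qed.

Lemma zetaS p k : (k < p)%N ->
  zeta R p p k.+1 = zeta R p p k + (p%:R + k.+1%:R)^-1 + (p%:R - k%:R)^-1.
Proof.
move=> kp; rewrite /zeta !subzn ?(ltnW kp) // -!PoszD !absz_nat.
have e : (p - k = (p - k.+1).+1)%N by rewrite -subnSK // subSS.
by rewrite -natrD -(natrB _ (ltnW kp)) e addnS !harmonic_numberS; ring.
Qed.

Section Stencil.
Variables p p' : nat.
Hypothesis hp : (p.-1 <= p' <= p)%N.
Let n := (p + p')%N.

Let le_p' : (p' <= p)%N. Proof. by case/andP: hp. Qed.
Let eU : uphalf n = p. Proof. by have [] := stencil_split hp. Qed.
Let eH : n./2 = p'. Proof. by have [] := stencil_split hp. Qed.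

Lemma phiE k : (k <= p')%N -> phi n k = Ccoef R p p k * Ccoef R p' p' k.
Proof.
elim: k => [|k ih] kp; first by rewrite !Ccoef0 mulr1.
have kp' : (k < p)%N := leq_trans kp le_p'.
apply: (mulfI (lt0r_neq0 (Acf_gt0 R n k))); rewrite phiS ih 1?ltnW //.
rewrite /Acf /Bcf eU eH.
transitivity ((p%:R - k%:R) * Ccoef R p p k * ((p'%:R - k%:R) * Ccoef R p' p' k)).
  by ring.
by rewrite -!CcoefS //; ring.
Qed.

(** The sum of the two zetas is minus the logarithmic derivative of Phi. *)
Lemma psiE k : (k <= p')%N ->
  psi n k = (zeta R p p k + zeta R p' p' k) * (Ccoef R p p k * Ccoef R p' p' k).
Proof.
elim: k => [|k ih] kp.
  by rewrite [LHS]/= /zeta !addr0 !subrr addr0 mul0r.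
have kp' : (k < p)%N := leq_trans kp le_p'.
apply: (mulfI (lt0r_neq0 (Acf_gt0 R n k))); rewrite psiS ih 1?ltnW // -!phiE ?(ltnW kp) //.
rewrite !zetaS // [in RHS]mulrCA phiS.
have h1 : p%:R - k%:R != 0 :> R by rewrite subr_eq0 eqr_nat gtn_eqF.
have h2 : p'%:R - k%:R != 0 :> R by rewrite subr_eq0 eqr_nat gtn_eqF.
have h3 : p%:R + k.+1%:R != 0 :> R by rewrite -natrD pnatr_eq0 addnS.
have h4 : p'%:R + k.+1%:R != 0 :> R by rewrite -natrD pnatr_eq0 addnS.
have -> : phi n k.+1 = Bcf R n k * phi n k / Acf R n k.+1.
  by rewrite -phiS mulrC mulKf // lt0r_neq0 // Acf_gt0.
by rewrite /Acf /Bcf eU eH natrD; field; rewrite nat1r h1 h2 h3 h4.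
Qed.

(** At the simple zero k = p of Phi only the derivative survives; it yields the terms with 1 - delta
    in the coefficient formulas. *)
Lemma psi_last : p = p'.+1 -> psi n p = Ccoef R p p p * Ccoef R p' p p / p%:R.
Proof.
move=> e; rewrite e; apply: (mulfI (lt0r_neq0 (Acf_gt0 R n p'))).
rewrite psiS phi_supp ?eH // /Bcf /Acf eU eH subrr !(mulr0, mul0r) !add0r phiE //.
have := @CcoefS p p'; rewrite e ltnSn => /(_ isT).
rewrite -(natr1 p') [p'%:R + 1 - _]addrAC subrr add0r mul1r => <-.
have -> : n%:R = p'%:R + 1 + p'%:R :> R by rewrite /n natrD [in LHS]e natr1.
have -> : Ccoef R p' p'.+1 p'.+1 =
    (p'%:R + 1) / (p'%:R + (p'%:R + 1)) * Ccoef R p' p' p'.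
  rewrite !Ccoef_nat // !subnn addnS !factS !natrM -(natr1 p') -(natr1 (p' + p')) natrD fact0.
  by field; rewrite fact_neq0 natr1 -natrD addnS pnatr_eq0.
by field; rewrite natr1 -natrD addnS !pnatr_eq0.
Qed.

(** The term with 1 - delta is the summand k = p of a single tail: the only one beyond p' if p = p'
    + 1, and absent if p = p'. *)
Lemma tail_sum (f : nat -> R) K j : (p < K)%N -> (j < p)%N ->
  (forall k, (p < k)%N -> f k = 0) ->
  \sum_(j.+1 <= k < K) f k = \sum_(j.+1 <= k < p'.+1) f k + (1 - (p == p')%:R) * f p.
Proof.
move=> pK jp f0; have jp' : (j.+1 <= p'.+1)%N by lia.
rewrite (big_cat_nat (n := p'.+1)) //=; last by lia.
congr (_ + _); have [e|e] : p = p' \/ p = p'.+1 by lia.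
  rewrite e eqxx subrr mul0r big_nat big1 // => k /andP[pk _].
  by rewrite f0 // e.
rewrite (_ : p == p' = false) ?subr0 ?mul1r; last by apply/eqP; lia.
rewrite big_ltn; last by lia.
rewrite -e big_nat big1 ?addr0 // => k /andP[pk _]; exact: f0.
Qed.

Lemma alpha_tail K j : (p < K)%N -> (j < p)%N ->
  alpha_nonneg R p p' j = \sum_(j.+1 <= k < K) dcf R n k.
Proof.
move=> pK jp; rewrite (tail_sum pK jp); last first.
  move=> k pk; rewrite /dcf phi_supp ?psi_supp ?eU ?eH ?(leq_ltn_trans le_p') //.
  by rewrite !(mulr0, mul0r) addr0.
rewrite /alpha_nonneg; congr (_ + _).
  apply: eq_big_nat => k /andP[jk kp]; rewrite /dcf phiE // psiE //.
  by field; rewrite pnatr_eq0 -lt0n (leq_trans _ jk).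
have [e|e] : p = p' \/ p = p'.+1 by lia.
  by rewrite e eqxx subrr !mul0r.
rewrite /dcf phi_supp ?eH ?[X in (_ < X)%N]e // psi_last //.
by field; rewrite e pnatr_eq0.
Qed.

Lemma a_tail K j : (p < K)%N -> (j < p)%N ->
  a_nonneg R p p' j = \sum_(j.+1 <= k < K) ecf R n k.
Proof.
move=> pK jp; rewrite (tail_sum pK jp); last first.
  move=> k pk; rewrite /ecf phi_supp ?psi_supp ?eU ?eH ?(leq_ltn_trans le_p') //.
  by rewrite !(mulr0, mul0r) addr0.
rewrite /a_nonneg; congr (_ + _).
  apply: eq_big_nat => k /andP[jk kp]; rewrite /ecf phiE // psiE //.
  by field; rewrite pnatr_eq0 -lt0n (leq_trans _ jk).
have [e|e] : p = p' \/ p = p'.+1 by lia.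
  by rewrite e eqxx subrr !mul0r.
rewrite /ecf phi_supp ?eH ?[X in (_ < X)%N]e // psi_last //.
by field; rewrite e pnatr_eq0.
Qed.

Lemma beta_pos j : (j < p')%N -> beta R p p' j.+1 = - (2 * (phi n j.+1 / j.+1%:R)).
Proof. by move=> jp; rewrite phiE // /beta /= -pmulrn; field; rewrite nat1r pnatr_eq0. Qed.

Lemma beta_neg j : (j < p')%N -> beta R p p' (Negz j) = - beta R p p' j.+1.
Proof.
move=> jp; rewrite /beta /= NegzE !CcoefN //; last exact: leq_trans jp le_p'.
by rewrite mulrNz invrN; ring.
Qed.

Lemma bcoef_pos j : (j < p')%N -> bcoef R p p' j.+1 = - (6 * (phi n j.+1 / j.+1%:R ^+ 2)).
Proof. by move=> jp; rewrite phiE // /bcoef /= -pmulrn; field; rewrite nat1r pnatr_eq0. Qed.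

Lemma bcoef_neg j : (j < p')%N -> bcoef R p p' (Negz j) = bcoef R p p' j.+1.
Proof.
move=> jp; rewrite /bcoef /= NegzE !CcoefN //; last exact: leq_trans jp le_p'.
by rewrite mulrNz sqrrN.
Qed.

End Stencil.

Lemma sumz_split (W : zmodType) a b (f : int -> W) :
  sumz a b f = \sum_(j < a) f (Negz j) + \sum_(j < b) f j.
Proof.
rewrite /sumz big_split_ord /=; congr (_ + _).
  rewrite (reindex_inj rev_ord_inj) /=; apply: eq_bigr => j _; congr f.
  by rewrite -subzn ?ltn_ord // NegzE; ring.
by apply: eq_bigr => j _; congr f; rewrite PoszD; ring.
Qed.

Lemma sumz_split0 (W : zmodType) a (f : int -> W) :
  sumz a a.+1 f = \sum_(j < a) (f (Negz j) + f j.+1) + f 0.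
Proof. by rewrite sumz_split big_ord_recl /= big_split /= addrAC addrA. Qed.

Definition sum_inv_sq m : R := \sum_(1 <= k < m.+1) k%:R ^- 2.

Lemma sum_inv_sqS m : sum_inv_sq m.+1 = sum_inv_sq m + m.+1%:R ^- 2.
Proof. by rewrite /sum_inv_sq big_nat_recr. Qed.

(** Each step adds 1 / m^2 for the half-index that grows to m, and the two half-indices grow in
    turn. This gives the two sums in b_0. *)
Lemma csum_d0E K n : (uphalf n < K)%N ->
  csum K (dcf R n) 0 = sum_inv_sq (uphalf n) + sum_inv_sq n./2.
Proof.
elim: n => [|n ih] nK.
  by rewrite (csum_eq0 _ _ (@dcf0 R)) /sum_inv_sq big_geq // addr0.
rewrite csum_d0_succ // ih; last exact: uphalf_ltW.
rewrite (_ : n.+1./2 = uphalf n) // (_ : uphalf n.+1 = n./2.+1) // sum_inv_sqS.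
by rewrite -addrA addrC.
Qed.

Lemma bcoef0 K p p' : (p.-1 <= p' <= p)%N -> (p < K)%N ->
  bcoef R p p' 0 = - 6 * csum K (dcf R (p + p')) 0.
Proof.
move=> hp pK; have [eU eH] := stencil_split hp.
rewrite csum_d0E ?eU ?eH // /bcoef eqxx.
have h m : sumz m m.+1 (fun i => if i == 0 then 0 else 3 / i%:~R ^+ 2) = 6 * sum_inv_sq m.
  rewrite sumz_split0 eqxx addr0 /sum_inv_sq big_add1 /= big_mkord mulr_sumr.
  apply: eq_bigr => j _; rewrite NegzE mulrNz sqrrN -pmulrn.
  by field; rewrite nat1r pnatr_eq0.
by rewrite !h; ring.
Qed.

(** The coefficients alpha and a are tails of [dcf] and [ecf], and the factor z - 1 differences the
    powers of z; summation by parts leaves sums with coefficients [dcf] and [ecf]. *)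
Lemma abel_sum K (f g : nat -> R) :
  \sum_(0 <= j < K) (\sum_(j.+1 <= k < K) f k) * (g j.+1 - g j) =
  \sum_(1 <= k < K) f k * (g k - g 0%N).
Proof.
elim: K => [|K ih]; first by rewrite !big_geq.
rewrite big_nat_recr //= [X in _ + X * _]big_geq // mul0r addr0.
have [->|K0] := posnP K; first by rewrite !big_geq.
rewrite [in RHS]big_nat_recr //= -ih -(telescope_sumr g (leq0n K)) mulr_sumr -big_split /=.
apply: eq_big_nat => j /andP[_ jK].
by rewrite big_nat_recr //= mulrDl.
Qed.

End CoefficientFormulas.

(** * Symbols of the stencils on the unit circle *)

Section Symbols.
Variable R : realType.
Implicit Types (e t : R) (k n K p : nat).

(* For e = 1 or -1 these are the points e^(it) and e^(-it), 0 <= t <= pi. *)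
Definition cis e t : R[i] := Complex (cos t) (e * sin t).

Lemma complex_ext (x y : R[i]) :
  complex.Re x = complex.Re y -> complex.Im x = complex.Im y -> x = y.
Proof. by case: x y => [a b] [c d] /= -> ->. Qed.

Lemma cisM e t s : e ^+ 2 = 1 -> cis e t * cis e s = cis e (t + s).
Proof.
move=> e2; apply: complex_ext => /=; rewrite ?cosD ?sinD; last by ring.
rewrite [X in _ - X](_ : _ = e ^+ 2 * (sin t * sin s)); last by ring.
by rewrite e2 mul1r.
Qed.

Lemma cisX e t k : e ^+ 2 = 1 -> cis e t ^+ k = cis e (k%:R * t).
Proof.
move=> e2; elim: k => [|k ih].
  by rewrite mul0r; apply: complex_ext; rewrite /= ?cos0 ?sin0 ?mulr0.
by rewrite exprS ih cisM // -natr1 mulrDl mul1r addrC.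
Qed.

Lemma cisV e t : e ^+ 2 = 1 -> (cis e t)^-1 = cis e (- t).
Proof.
move=> e2; have h : cis e t * cis e (- t) = 1.
  by rewrite cisM // subrr; apply: complex_ext; rewrite /= ?cos0 ?sin0 ?mulr0.
have z0 : cis e t != 0.
  by apply/eqP => z0; move/eqP: h; rewrite z0 mul0r eq_sym oner_eq0.
by apply: (mulfI z0); rewrite h mulfV.
Qed.

Lemma cisXz e t k : e ^+ 2 = 1 -> cis e t ^ k%:Z = cis e (k%:R * t).
Proof. exact: cisX. Qed.

Lemma cisXNz e t k : e ^+ 2 = 1 -> cis e t ^ Negz k = cis e (- (k.+1%:R * t)).
Proof. by move=> e2; rewrite NegzE -exprnN cisX // cisV. Qed.

Definition symbol a b (f : int -> R) (z : R[i]) : R[i] :=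
  sumz a b (fun k : int => real_complex R (f k) * z ^ k).

Section Stencil.
Variables (p p' K : nat) (e t : R).
Hypotheses (hp : (p.-1 <= p' <= p)%N) (pK : (p < K)%N) (e2 : e ^+ 2 = 1).
Let n := (p + p')%N.
Let z := cis e t.

Lemma widen_tail_sum (f g : nat -> R) (c : nat -> R) :
  (forall k, (p < k)%N -> f k = 0) ->
  (forall j, (j < p)%N -> c j = \sum_(j.+1 <= k < K) f k) ->
  \sum_(j < p) c j * (g j.+1 - g j) = \sum_(1 <= k < K) f k * (g k - g 0%N).
Proof.
move=> f0 cE; rewrite -abel_sum (big_cat_nat (n := p)) //=; last exact: ltnW.
rewrite [X in _ = _ + X]big_nat [X in _ = _ + X]big1 ?addr0 ?big_mkord.
  by apply: eq_bigr => j _; rewrite cE.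
move=> j /andP[pj _]; rewrite big_nat big1 ?mul0r // => k /andP[jk _].
by rewrite f0 // (leq_ltn_trans pj).
Qed.

Lemma cisDN s : cis e s + cis e (- s) = real_complex R (2 * cos s).
Proof. by apply: complex_ext; rewrite /= ?cosN ?sinN; ring. Qed.

Lemma cisBN s : cis e s - cis e (- s) = Complex 0 (e * (2 * sin s)).
Proof. by apply: complex_ext; rewrite /= ?cosN ?sinN; ring. Qed.

Lemma pure_imaginary_sum (I : Type) (r : seq I) (f : I -> R) :
  \sum_(i <- r) Complex 0 (e * f i) = Complex 0 (e * \sum_(i <- r) f i).
Proof.
elim: r => [|i r ih]; first by rewrite !big_nil mulr0.
by rewrite !big_cons ih mulrDr; apply: complex_ext; rewrite /= ?addr0.
Qed.

(** The powers j and - 1 - j are paired because alpha is odd and a is even under this reflection;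
    the factor z - 1 makes the frequencies symmetric about 0. *)
Lemma cis_shift_diff (a b : R[i]) j :
  (z - 1) * (a * z ^ Negz j + b * z ^ j%:Z) =
  a * cis e (- (j%:R * t)) - a * cis e (- (j.+1%:R * t))
  + (b * cis e (j.+1%:R * t) - b * cis e (j%:R * t)).
Proof.
rewrite cisXNz // cisXz //.
transitivity (a * (z * cis e (- (j.+1%:R * t)) - cis e (- (j.+1%:R * t)))
  + b * (z * cis e (j%:R * t) - cis e (j%:R * t))); first by ring.
have e1 : t + j%:R * t = j.+1%:R * t by rewrite -natr1; ring.
have e3 : t - j.+1%:R * t = - (j%:R * t) by rewrite -natr1; ring.
by rewrite !cisM // e1 e3; ring.
Qed.

Lemma symbol_alpha : (z - 1) * symbol p p (alpha R p p') z = real_complex R (- Ff K n t).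
Proof.
have [eU eH] := stencil_split hp.
rewrite /symbol sumz_split -big_split mulr_sumr /=.
rewrite (eq_bigr (fun j : 'I_p => real_complex R
   (alpha_nonneg R p p' j * (2 * cos (j.+1%:R * t) - 2 * cos (j%:R * t))))); last first.
  move=> j _; rewrite cis_shift_diff rmorphN rmorphM rmorphB /= -!cisDN.
  by ring.
rewrite -rmorph_sum (widen_tail_sum (f := dcf R n) (fun j => 2 * cos (j%:R * t))).
- congr (real_complex R _); rewrite /Ff mul0r cos0 /csum -sumrB mulr_sumr -sumrN.
  by apply: eq_bigr => k _; rewrite mulr0 cos0; ring.
- move=> k pk; rewrite /dcf phi_supp ?psi_supp ?eU ?eH //; last first.
    by case/andP: hp => _ /leq_ltn_trans ->.
  by rewrite !(mulr0, mul0r) addr0.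
- by move=> j jp; apply: alpha_tail.
Qed.

Lemma symbol_acoef : (z - 1) * symbol p p (acoef R p p') z = Complex 0 (e * Ef K n t).
Proof.
have [eU eH] := stencil_split hp.
rewrite /symbol sumz_split -big_split mulr_sumr /=.
rewrite (eq_bigr (fun j : 'I_p => Complex 0 (e *
   (a_nonneg R p p' j * (2 * sin (j.+1%:R * t) - 2 * sin (j%:R * t)))))); last first.
  move=> j _; rewrite cis_shift_diff.
  transitivity (real_complex R (a_nonneg R p p' j) *
    ((cis e (j.+1%:R * t) - cis e (- (j.+1%:R * t)))
     - (cis e (j%:R * t) - cis e (- (j%:R * t))))); first by ring.
  by rewrite !cisBN; apply: complex_ext; rewrite /=; ring.
rewrite pure_imaginary_sum (widen_tail_sum (f := ecf R n) (fun j => 2 * sin (j%:R * t))).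
- congr (Complex 0 (e * _)); rewrite /Ef mul0r sin0 /ssum mulr_sumr.
  by apply: eq_bigr => k _; rewrite mulr0; ring.
- move=> k pk; rewrite /ecf phi_supp ?psi_supp ?eU ?eH //; last first.
    by case/andP: hp => _ /leq_ltn_trans ->.
  by rewrite !(mulr0, mul0r) addr0.
- by move=> j jp; apply: a_tail.
Qed.

Lemma widen_phi_sum (c : nat -> R) :
  \sum_(j < p') phi R n j.+1 * c j.+1 = \sum_(1 <= k < K) phi R n k * c k.
Proof.
have [eU eH] := stencil_split hp; have /andP[_ pp] := hp.
rewrite [RHS](big_cat_nat (n := p'.+1)) //=; last exact: leq_ltn_trans pK.
rewrite [X in _ = _ + X]big_nat [X in _ = _ + X]big1 ?addr0.
  by rewrite big_add1 /= big_mkord.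
by move=> k /andP[pk _]; rewrite phi_supp ?eH // mul0r.
Qed.

Lemma symbol_beta : symbol p' p'.+1 (beta R p p') z = Complex 0 (e * - rhof K n t).
Proof.
rewrite /symbol sumz_split0 [beta _ _ _ 0]/= rmorph0 mul0r addr0.
rewrite (eq_bigr (fun j : 'I_p' => Complex 0 (e *
   (phi R n j.+1 * (- 4 * sin (j.+1%:R * t) / j.+1%:R))))); last first.
  move=> j _; rewrite beta_neg ?ltn_ord // beta_pos ?ltn_ord // cisXNz // cisXz // -/n.
  by apply: complex_ext; rewrite /= ?cosN ?sinN; ring.
rewrite pure_imaginary_sum (widen_phi_sum (fun k => - 4 * sin (k%:R * t) / k%:R)).
congr (Complex 0 (e * _)); rewrite /rhof /ssum mulr_sumr -sumrN.
by apply: eq_bigr => k _; ring.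
Qed.

Lemma symbol_bcoef : symbol p' p'.+1 (bcoef R p p') z = real_complex R (- vf K n t).
Proof.
rewrite /symbol sumz_split0 (bcoef0 R hp pK) expr0z mulr1.
rewrite (eq_bigr (fun j : 'I_p' => real_complex R
   (phi R n j.+1 * (- 12 * cos (j.+1%:R * t) / j.+1%:R ^+ 2)))); last first.
  move=> j _; rewrite bcoef_neg ?ltn_ord // bcoef_pos ?ltn_ord // cisXNz // cisXz // -/n.
  by apply: complex_ext; rewrite /= ?cosN ?sinN; ring.
rewrite -rmorph_sum -rmorphD (widen_phi_sum (fun k => - 12 * cos (k%:R * t) / k%:R ^+ 2)).
congr (real_complex R _).
have -> : \sum_(1 <= k < K) phi R n k * (- 12 * cos (k%:R * t) / k%:R ^+ 2) =
    - (12 * csum K (fun k => phi R n k / k%:R ^+ 2) t).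
  by rewrite /csum mulr_sumr -sumrN; apply: eq_bigr => k _; ring.
by rewrite /vf -/n; ring.
Qed.

End Stencil.
End Symbols.

(** * Circulant block matrices *)

Section LinearAlgebra.

Lemma char_poly_intertwine (F : fieldType) m (A B U : 'M[F]_m) :
  U \in unitmx -> A *m U = U *m B -> char_poly A = char_poly B.
Proof.
rewrite unitmxE unitfE => U0 AU.
have e : char_poly_mx A *m map_mx polyC U = map_mx polyC U *m char_poly_mx B.
  by rewrite /char_poly_mx mulmxBl mulmxBr -!map_mxM AU scalar_mxC.
have := congr1 determinant e; rewrite !det_mulmx det_map_mx [RHS]mulrC.
by apply: mulIf; rewrite polyC_eq0.
Qed.

(** Column elimination, possible because diagonal blocks commute. The nonzero factor det(diag d)
    cancels; for characteristic polynomials it is the product of the X - d_i. *)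
Lemma det_block_diag (T : idomainType) m (a b c d : 'rV[T]_m) :
  (forall i, d 0 i != 0) ->
  \det (block_mx (diag_mx a) (diag_mx b) (diag_mx c) (diag_mx d)) =
  \prod_i (a 0 i * d 0 i - b 0 i * c 0 i).
Proof.
move=> d0.
have e : block_mx (diag_mx a) (diag_mx b) (diag_mx c) (diag_mx d) *m
    block_mx (diag_mx d) 0 (- diag_mx c) 1%:M =
    block_mx (diag_mx (\row_i (a 0 i * d 0 i - b 0 i * c 0 i))) (diag_mx b) 0 (diag_mx d).
  rewrite mulmx_block !mulmx0 !mulmx1 !add0r !mulmxN !mulmx_diag; congr block_mx.
    by apply/matrixP => i j; rewrite !mxE -mulrnBl.
  by apply/matrixP => i j; rewrite !mxE mulrC subrr.
have := congr1 determinant e; rewrite det_mulmx det_lblock det_ublock !det_diag det1 mulr1.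
rewrite [X in _ = X * _](eq_bigr (fun i => a 0 i * d 0 i - b 0 i * c 0 i)); last first.
  by move=> i _; rewrite mxE.
by apply: mulIf; apply/prodf_neq0 => i _.
Qed.

Lemma char_poly_block_diag (F : fieldType) m (a b c d : 'rV[F]_m) :
  char_poly (block_mx (diag_mx a) (diag_mx b) (diag_mx c) (diag_mx d)) =
  \prod_i (('X - (a 0 i)%:P) * ('X - (d 0 i)%:P) - (b 0 i * c 0 i)%:P).
Proof.
rewrite /char_poly /char_poly_mx map_block_mx scalar_mx_block.
rewrite opp_block_mx add_block_mx !add0r.
have h (f : 'rV[F]_m) : 'X%:M - map_mx polyC (diag_mx f) = diag_mx (\row_i ('X - (f 0 i)%:P)).
  by apply/matrixP => i j; rewrite !mxE rmorphMn -mulrnBl.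
have h' (f : 'rV[F]_m) : - map_mx polyC (diag_mx f) = diag_mx (\row_i - (f 0 i)%:P).
  by apply/matrixP => i j; rewrite !mxE rmorphMn mulNrn.
rewrite !h !h' det_block_diag => [|i]; last by rewrite mxE polyXsubC_eq0.
by apply: eq_bigr => i _; rewrite !mxE mulrNN polyCM.
Qed.

Lemma unity_roots (F : closedFieldType) m : (0 < m)%N -> m%:R != 0 :> F ->
  exists2 z : 'I_m -> F, injective z & forall x : F, x ^+ m = 1 <-> exists i, x = z i.
Proof.
move=> m0 mF; have [r] := closed_field_poly_normal ('X^m - 1 : {poly F}).
rewrite (monicP (monicXnsubC 1 m0)) scale1r => e.
have ru : uniq r by rewrite -separable_prod_XsubC -e separable_Xn_sub_1.
have rs : size r = m.
  by apply: succn_inj; rewrite -(size_prod_XsubC r id) -e size_XnsubC.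
exists (fun i => nth 0 r i) => [i j /eqP|x].
  by rewrite nth_uniq ?rs // => /eqP/val_inj.
have -> : x ^+ m = 1 <-> x \in r.
  rewrite -root_prod_XsubC -e rootE !hornerE subr_eq0; exact: (rwP eqP).
split=> [xr|[i ->]]; last by rewrite mem_nth // rs.
have xi : (index x r < m)%N by rewrite -rs index_mem.
by exists (Ordinal xi); rewrite nth_index.
Qed.

End LinearAlgebra.

(** * Diagonalization by Fourier vectors *)

Section Circulant.
Variables (R : realType) (n : nat).
Local Notation N := n.+1.
Local Notation rc := (real_complex R).
Implicit Types (j : 'I_N) (k l : int) (z x y : R[i]) (X Y : 'M[R]_N).

Lemma shift_indexD j k l : shift_index (shift_index j k) l = shift_index j (k + l).
Proof. by rewrite /shift_index mulrzDr addrA. Qed.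

Lemma shift_index0 j : shift_index j 0 = j.
Proof. by rewrite /shift_index mulr0z addr0. Qed.

Definition shift_mx k : 'M[R]_N := \matrix_(i, j) (j == shift_index i k)%:R.

Lemma shift_mxE (T : pzRingType) (m : nat) k
  (f : {rmorphism R -> T}) (w : 'M[T]_(N, m)) j (l : 'I_m) :
  (map_mx f (shift_mx k) *m w) j l = w (shift_index j k) l.
Proof.
rewrite mxE (bigD1 (shift_index j k)) //= !mxE eqxx rmorph1 mul1r big1 ?addr0 // => i ne.
by rewrite !mxE (negbTE ne) rmorph0 mul0r.
Qed.

Lemma shift_mxM k l : shift_mx k *m shift_mx l = shift_mx (k + l).
Proof.
apply/matrixP => i j; have := shift_mxE k idfun (shift_mx l) i j.
by rewrite (map_mx_id (fun=> erefl)) => ->; rewrite !mxE shift_indexD.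
Qed.

Lemma shift_mx0 : shift_mx 0 = 1%:M.
Proof. by apply/matrixP => i j; rewrite !mxE shift_index0 eq_sym. Qed.

Lemma cyclic_shiftXz k : cyclic_shift R n ^ k = shift_mx k.
Proof.
have h m : cyclic_shift R n ^+ m = shift_mx m%:Z.
  elim: m => [|m ih]; first by rewrite shift_mx0.
  by rewrite exprS ih -[LHS]/(shift_mx 1 *m _) shift_mxM.
case: k => m; first exact: h.
rewrite NegzE -exprnN h.
have e1 : shift_mx m.+1 * shift_mx (- m.+1%:Z) = 1.
  by rewrite -[LHS]/(_ *m _) shift_mxM subrr shift_mx0.
have e2 : shift_mx (- m.+1%:Z) * shift_mx m.+1 = 1.
  by rewrite -[LHS]/(_ *m _) shift_mxM addNr shift_mx0.
have u : shift_mx m.+1 \is a GRing.unit by apply/unitrP; exists (shift_mx (- m.+1%:Z)).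
by apply: (mulrI u); rewrite e1 mulrV.
Qed.

Lemma laurent_shiftE a b (f : int -> R) (w : 'cV[R]_N) j :
  (laurent_shift n a b f *m w) j 0 = sumz a b (fun k => f k * w (shift_index j k) 0).
Proof.
rewrite /laurent_shift /sumz mulmx_suml summxE; apply: eq_bigr => i _.
rewrite -scalemxAl mxE cyclic_shiftXz; congr (_ * _).
by have := shift_mxE (i%:Z - a%:Z) idfun w j 0; rewrite (map_mx_id (fun=> erefl)).
Qed.

Definition fourier_col z : 'cV[R[i]]_N := \col_i z ^+ i.

(** An eigenvector relation with a common eigenvector is stable under sums and products, so symbols
    of blocks are computed piece by piece. *)
Definition has_symbol X z x := map_mx rc X *m fourier_col z = x *: fourier_col z.

Section Mode.
Variable z : R[i].
Hypothesis zN : z ^+ N = 1.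

Let z0 : z != 0.
Proof. by apply/eqP => z0; move/eqP: zN; rewrite z0 expr0n eq_sym oner_eq0. Qed.

(** Addition in ['I_N] reduces modulo N, which powers of z do not see since z^N = 1. *)
Let zD (i j : 'I_N) : z ^+ (i + j)%R = z ^+ i * z ^+ j.
Proof. by rewrite -exprD /= expr_mod. Qed.

Let zshift k : z ^+ (@inZp n 1 *~ k) = z ^ k.
Proof.
have h m : z ^+ (@inZp n 1 *+ m) = z ^+ m.
  elim: m => // m ih; rewrite mulrS zD ih exprS; congr (_ * _).
  by rewrite /= expr_mod.
case: k => m; first exact: h.
rewrite NegzE mulrNz -exprnN; apply: (mulfI (expf_neq0 m.+1 z0)).
have := zD (inZp 1 *+ m.+1) (- (inZp 1 *+ m.+1)); rewrite subrr h => <-.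
by rewrite mulfV ?expf_neq0.
Qed.

Lemma has_symbol_shift k : has_symbol (shift_mx k) z (z ^ k).
Proof.
apply/matrixP => i j; rewrite shift_mxE !mxE /shift_index zD zshift.
exact: mulrC.
Qed.

Lemma has_symbolD X Y x y : has_symbol X z x -> has_symbol Y z y -> has_symbol (X + Y) z (x + y).
Proof. by rewrite /has_symbol map_mxD mulmxDl scalerDl => -> ->. Qed.

Lemma has_symbolZ X x (a : R) : has_symbol X z x -> has_symbol (a *: X) z (rc a * x).
Proof. by rewrite /has_symbol map_mxZ -scalemxAl => ->; rewrite scalerA. Qed.

Lemma has_symbolN X x : has_symbol X z x -> has_symbol (- X) z (- x).
Proof. by rewrite /has_symbol map_mxN mulNmx scaleNr => ->. Qed.

Lemma has_symbolM X Y x y : has_symbol X z x -> has_symbol Y z y -> has_symbol (X * Y) z (x * y).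
Proof.
rewrite /has_symbol => hX hY; rewrite -[X * Y]/(X *m Y) map_mxM -mulmxA hY.
by rewrite -scalemxAr hX scalerA mulrC.
Qed.

Lemma has_symbol_shift1 : has_symbol (cyclic_shift R n - 1) z (z - 1).
Proof.
apply: has_symbolD; first exact: (has_symbol_shift 1).
by apply: has_symbolN; have := has_symbol_shift 0; rewrite shift_mx0.
Qed.

Lemma has_symbol_laurent a b f : has_symbol (laurent_shift n a b f) z (symbol a b f z).
Proof.
rewrite /symbol /laurent_shift /sumz.
elim/big_ind2: _ => [|X1 x1 X2 x2|i _]; last 1 first.
- by rewrite cyclic_shiftXz; apply/has_symbolZ/has_symbol_shift.
- by rewrite /has_symbol map_mx0 mul0mx scale0r.
- exact: has_symbolD.
Qed.

End Mode.

(** The columns of the Vandermonde matrix are the Fourier vectors. *)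
Lemma fourier_diag (zs : 'I_N -> R[i]) X (x : 'I_N -> R[i]) :
  (forall i, has_symbol X (zs i) (x i)) ->
  map_mx rc X *m Vandermonde N (\row_i zs i) =
  Vandermonde N (\row_i zs i) *m diag_mx (\row_i x i).
Proof.
move=> h; apply/matrixP => i l; rewrite mul_mx_diag !mxE.
have := congr1 (fun A : 'cV_N => A i 0) (h l); rewrite /= !mxE mulrC => <-.
by apply: eq_bigr => j _; rewrite !mxE.
Qed.

Lemma Vandermonde_unit (zs : 'I_N -> R[i]) : injective zs ->
  Vandermonde N (\row_i zs i) \in unitmx.
Proof.
move=> zI; rewrite unitmxE unitfE det_Vandermonde; apply/prodf_neq0 => i _.
apply/prodf_neq0 => j ij; rewrite !mxE subr_eq0; apply: contraTneq ij => /zI ->.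
by rewrite ltnn.
Qed.

Lemma char_poly_circulant (zs : 'I_N -> R[i]) X1 X2 X3 X4 (x1 x2 x3 x4 : 'I_N -> R[i]) :
  injective zs -> (forall i, has_symbol X1 (zs i) (x1 i)) ->
  (forall i, has_symbol X2 (zs i) (x2 i)) -> (forall i, has_symbol X3 (zs i) (x3 i)) ->
  (forall i, has_symbol X4 (zs i) (x4 i)) ->
  char_poly (map_mx rc (block_mx X1 X2 X3 X4)) =
  \prod_i (('X - (x1 i)%:P) * ('X - (x4 i)%:P) - (x2 i * x3 i)%:P).
Proof.
move=> zI h1 h2 h3 h4; set U := Vandermonde N (\row_i zs i).
rewrite (@char_poly_intertwine _ _ _ (block_mx (diag_mx (\row_i x1 i)) (diag_mx (\row_i x2 i))
  (diag_mx (\row_i x3 i)) (diag_mx (\row_i x4 i))) (block_mx U 0 0 U)).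
- rewrite char_poly_block_diag; apply: eq_bigr => i _.
  by rewrite !mxE.
- by rewrite unitmxE det_ublock unitrM -!unitmxE Vandermonde_unit.
- rewrite map_block_mx !mulmx_block !mulmx0 !mul0mx !addr0 !add0r.
  by rewrite !(fourier_diag h1, fourier_diag h2, fourier_diag h3, fourier_diag h4).
Qed.

End Circulant.

(** * Stability of the full system *)

Section Stability.
Variables (R : realType) (n r r' p p' q q' : nat).
Hypotheses (hr : (r.-1 <= r' <= r)%N) (hr1 : (1 <= r + r')%N).
Hypotheses (hp : (p.-1 <= p' <= p)%N) (hp1 : (1 <= p + p')%N).
Hypotheses (hq : (q.-1 <= q' <= q)%N) (hq1 : (1 <= q + q')%N).

Local Notation N := n.+1.
Local Notation rc := (real_complex R).
Implicit Types (z lambda : R[i]) (s Pe : R).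

Let K := (r + p + q).+1.
Let rK : (r < K)%N. Proof. by rewrite /K; lia. Qed.
Let pK : (p < K)%N. Proof. by rewrite /K; lia. Qed.
Let qK : (q < K)%N. Proof. by rewrite /K; lia. Qed.
Let rK' : (uphalf (r + r') < K)%N. Proof. by have [->] := stencil_split hr. Qed.
Let pK' : (uphalf (p + p') < K)%N. Proof. by have [->] := stencil_split hp. Qed.
Let qK' : (uphalf (q + q') < K)%N. Proof. by have [->] := stencil_split hq. Qed.

Definition M11 : 'M[R]_N := (cyclic_shift R n - 1) * laurent_shift n p p (alpha R p p').
Definition M12 Pe : 'M[R]_N := (cyclic_shift R n - 1) * laurent_shift n p' p'.+1 (beta R p p')
  - Pe *: (cyclic_shift R n - 1).
Definition M21 Pe : 'M[R]_N := laurent_shift n q q (acoef R q q')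
  - Pe *: laurent_shift n r r (alpha R r r').
Definition M22 Pe : 'M[R]_N := laurent_shift n q' q'.+1 (bcoef R q q')
  - Pe *: laurent_shift n r' r'.+1 (beta R r r').

Lemma Mmatrix_block Pe : Mmatrix n r r' p p' q q' Pe = block_mx M11 (M12 Pe) (M21 Pe) (M22 Pe).
Proof.
rewrite /Mmatrix /Dmatrix /Kmatrix scale_block_mx opp_block_mx add_block_mx.
by rewrite scaler0 oppr0 add0r /M11 /M12 /M21 /M22 ![- _ + _]addrC.
Qed.

(** Characteristic polynomial of the 2 by 2 symbol of s M at z. The scale s covers both M itself, s
    = 1, and the ODE system, s = nu / h^2. *)
Definition mode_poly s Pe z : {poly R[i]} :=
  ('X - (rc s * ((z - 1) * symbol p p (alpha R p p') z))%:P) *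
  ('X - (rc s * (symbol q' q'.+1 (bcoef R q q') z
      - rc Pe * symbol r' r'.+1 (beta R r r') z))%:P)
  - ((rc s * ((z - 1) * symbol p' p'.+1 (beta R p p') z - rc Pe * (z - 1))) *
     (rc s * (symbol q q (acoef R q q') z - rc Pe * symbol r r (alpha R r r') z)))%:P.

Lemma char_poly_Mmatrix s Pe (zs : 'I_N -> R[i]) : injective zs -> (forall i, zs i ^+ N = 1) ->
  char_poly (map_mx rc (s *: Mmatrix n r r' p p' q q' Pe)) = \prod_i mode_poly s Pe (zs i).
Proof.
move=> zI zN; rewrite Mmatrix_block scale_block_mx.
apply: (char_poly_circulant zI) => i; apply: has_symbolZ.
- by apply: has_symbolM; [exact: has_symbol_shift1 | exact: has_symbol_laurent].
- apply: has_symbolD.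
    by apply: has_symbolM; [exact: has_symbol_shift1 | exact: has_symbol_laurent].
  by apply/has_symbolN/has_symbolZ/has_symbol_shift1.
- apply: has_symbolD; first exact: has_symbol_laurent.
  by apply/has_symbolN/has_symbolZ/has_symbol_laurent.
- apply: has_symbolD; first exact: has_symbol_laurent.
  by apply/has_symbolN/has_symbolZ/has_symbol_laurent.
Qed.

Local Notation rho := (@rhof R K).
Local Notation F := (@Ff R K).
Local Notation v := (@vf R K).
Local Notation E := (@Ef R K).

(** Only the product of the off-diagonal entries enters, so the factor z - 1 of the upper one is
    moved to the lower one, where it turns G into the real - F and A into the imaginary E. *)
Lemma mode_polyE s Pe e t : e ^+ 2 = 1 -> mode_poly s Pe (cis e t) =
  ('X + (rc s * rc (F (p + p')%N t))%:P) *
  ('X + (rc s * Complex (v (q + q')%N t) (- (e * Pe * rho (r + r')%N t)))%:P)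
  + (rc s ^+ 2 * (Complex Pe (e * rho (p + p')%N t) *
       Complex (Pe * F (r + r')%N t) (e * E (q + q')%N t)))%:P.
Proof.
move=> e2; rewrite /mode_poly.
have e1 : (cis e t - 1) * symbol p p (alpha R p p') (cis e t) = rc (- F (p + p')%N t).
  exact: symbol_alpha.
have e3 : (cis e t - 1) * symbol r r (alpha R r r') (cis e t) = rc (- F (r + r')%N t).
  exact: symbol_alpha.
have e4 : (cis e t - 1) * symbol q q (acoef R q q') (cis e t) = Complex 0 (e * E (q + q')%N t).
  exact: symbol_acoef.
rewrite e1 (symbol_bcoef t hq qK e2) (symbol_beta t hr rK e2) (symbol_beta t hp pK e2).
set z := cis e t in e1 e3 e4 *.
rewrite [X in _ - X%:P](_ : _ = - (rc s ^+ 2 * (Complex Pe (e * rho (p + p')%N t) *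
       Complex (Pe * F (r + r')%N t) (e * E (q + q')%N t)))); last first.
  transitivity (rc s ^+ 2 * ((Complex 0 (e * - rho (p + p')%N t) - rc Pe) *
    ((z - 1) * symbol q q (acoef R q q') z - rc Pe * ((z - 1) * symbol r r (alpha R r r') z)))).
    by ring.
  rewrite e3 e4 -[RHS]mulrN -[X in _ = _ * X]mulNr; congr (_ * (_ * _)).
    by apply: complex_ext; rewrite /=; ring.
  by apply: complex_ext; rewrite /=; ring.
rewrite polyCN opprK; congr (_ * _ + _).
  by rewrite rmorphN mulrN polyCN opprK.
rewrite -polyCN -mulrN; congr (_ + (_ * _)%:P).
by apply: complex_ext; rewrite /=; ring.
Qed.

Lemma mode_poly_root s Pe e t lambda : 0 < s -> e ^+ 2 = 1 -> 0 < t <= pi ->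
  root (mode_poly s Pe (cis e t)) lambda -> complex.Re lambda < 0.
Proof.
move=> s0 e2 ht; rewrite mode_polyE // rootE !(hornerD, hornerM, hornerX, hornerC) => /eqP h.
pose x := complex.Re lambda / s; pose y := complex.Im lambda / s.
have sn0 : s != 0 by rewrite lt0r_neq0.
have lE : lambda = rc s * Complex x y.
  by apply: complex_ext; rewrite /= !mul0r ?subr0 ?addr0 mulrC divfK.
have s2 : rc s ^+ 2 != 0 by rewrite expf_neq0 // fmorph_eq0.
have {}h : (Complex x y + rc (F (p + p')%N t)) *
    (Complex x y + Complex (v (q + q')%N t) (- (e * Pe * rho (r + r')%N t)))
    + Complex Pe (e * rho (p + p')%N t) *
       Complex (Pe * F (r + r')%N t) (e * E (q + q')%N t) = 0.
  by apply: (mulfI s2); rewrite mulr0 -[RHS]h lE; ring.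
have hre := congr1 (@complex.Re R) h; have him := congr1 (@complex.Im R) h.
rewrite /= !addr0 in hre him.
have : x < 0; last by rewrite /x pmulr_llt0 // invr_gt0.
(* Taking e y as imaginary part reduces e = -1 to e = 1 by complex conjugation. *)
apply: (@mode_stable R K (p + p') (q + q') (r + r') t Pe x (e * y)) => //.
  transitivity (0 + (1 - e ^+ 2) * (y ^+ 2 - rho (p + p')%N t * E (q + q')%N t)).
    by rewrite -hre; ring.
  by rewrite e2 subrr mul0r addr0.
transitivity (e * 0 + (1 - e ^+ 2) * (Pe * (E (q + q')%N t + rho (p + p')%N t * F (r + r')%N t
    - F (p + p')%N t * rho (r + r')%N t) - Pe * rho (r + r')%N t * x)).
  by rewrite -him; ring.
by rewrite e2 subrr mul0r addr0 mulr0.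
Qed.

(** At z = 1 the factor z - 1 kills the first row of the symbol, which expresses conservation of
    mass and produces the eigenvalue 0. *)
Lemma mode_poly_1 s Pe : mode_poly s Pe 1 = 'X * ('X + (rc (s * v (q + q')%N 0))%:P).
Proof.
have z1 : cis 1 0 = 1 :> R[i] by rewrite /cis sin0 cos0 mulr0.
rewrite -z1 mode_polyE ?expr1n // !F_0 !E_0 /rhof !ssum0 !mulr0 oppr0 !rmorph0 ?mulr0 !addr0.
by congr (_ * (_ + _%:P)); rewrite rmorphM.
Qed.

Lemma root_of_unity_cis z : z ^+ N = 1 ->
  exists e t, [/\ e ^+ 2 = 1, 0 <= t <= pi & z = cis e t].
Proof.
move=> zN.
have z1 : `|z| = 1.
  by apply/eqP; rewrite -(@pexpr_eq1 _ _ N) // -normrX zN normr1.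
have := add_Re2_Im2 z; rewrite z1 expr1n => /(congr1 (@complex.Re R)) /= h.
have hx : -1 <= complex.Re z <= 1.
  rewrite -ler_norml -(@ler_pXn2r _ 2) ?nnegrE // expr1n.
  by rewrite real_normK ?num_real // -h lerDl sqr_ge0.
have hs : sin (acos (complex.Re z)) = `|complex.Im z|.
  by rewrite sin_acos // -h addrC addKr sqrtr_sqr.
have hc : cos (acos (complex.Re z)) = complex.Re z by rewrite acosK // in_itv.
exists (if 0 <= complex.Im z then 1 else -1), (acos (complex.Re z)); split.
- by case: ifP; rewrite ?expr1n ?sqrrN ?expr1n.
- by rewrite acos_ge0 // acos_lepi.
apply: complex_ext => /=; first by rewrite hc.
rewrite hs; case: ifPn => [/ger0_norm -> | ]; first by rewrite mul1r.
by rewrite -ltNge => /ltr0_norm ->; rewrite mulN1r opprK.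
Qed.

Lemma stable_Mmatrix s Pe : 0 < s -> stable_mx (map_mx rc (s *: Mmatrix n r r' p p' q q' Pe)).
Proof.
move=> s0 lambda; rewrite eigenvalue_root_char => lr.
have Nn0 : N%:R != 0 :> R[i] by rewrite pnatr_eq0.
have [zs zI zE] := unity_roots (ltn0Sn n) Nn0.
have zN i : zs i ^+ N = 1 by apply/zE; exists i.
move: lr; rewrite (char_poly_Mmatrix s Pe zI zN).
have mode i x : root (mode_poly s Pe (zs i)) x -> zs i != 1 -> complex.Re x < 0.
  have [e [t [e2 /andP[t0 tpi] ->]]] := root_of_unity_cis (zN i).
  move=> hroot ne; apply: mode_poly_root hroot => //; rewrite tpi andbT lt_neqAle t0 andbT.
  by apply: contra ne => /eqP <-; rewrite /cis sin0 cos0 mulr0.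
have v0 : 0 < s * v (q + q')%N 0 by rewrite mulr_gt0 // v_gt0 // lexx pi_ge0.
rewrite rootE horner_prod => /prodf_eq0[i _ hi].
have [zi1|] := eqVneq (zs i) 1; last by left; exact: mode hi _.
move: hi; rewrite zi1 mode_poly_1 hornerM mulf_eq0 hornerX => /orP[/eqP l0|]; last first.
  rewrite hornerD hornerX hornerC addr_eq0 => /eqP ->; left.
  by rewrite -rmorphN /= oppr_lt0.
right; rewrite l0; split => //.
(* Simplicity of 0: the mode z = 1 contributes one factor X and a cofactor nonzero at 0 because v(0)
   > 0; every other mode has z different from 1, hence only roots of negative real part. *)
rewrite (bigD1 i) //= zi1 mode_poly_1 -mulrA mupMl.
  by rewrite -['X](subr0) -polyC0 -['X - _]expr1 mup_XsubCX eqxx.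
rewrite rootE hornerM mulf_neq0 //.
  by rewrite hornerD hornerX hornerC add0r fmorph_eq0 lt0r_neq0.
rewrite horner_prod; apply/prodf_neq0 => j ji; apply/negP => hj.
have : complex.Re (0 : R[i]) < 0 by apply: mode hj _; rewrite -zi1 (inj_eq zI).
by rewrite ltxx.
Qed.

Lemma shift_subE (u : 'cV[R]_N) j :
  ((cyclic_shift R n - 1) *m u) j 0 = u (shift_index j 1) 0 - u j 0.
Proof.
rewrite mulmxBl mul1mx !mxE; congr (_ - _).
by have := shift_mxE 1 idfun u j 0; rewrite (map_mx_id (fun=> erefl)) mxE.
Qed.

Lemma shift_laurentE a b (f : int -> R) (w : 'cV[R]_N) j :
  ((cyclic_shift R n - 1) * laurent_shift n a b f *m w) j 0 =
  sumz a b (fun k => f k * w (shift_index (shift_index j 1) k) 0)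
  - sumz a b (fun k => f k * w (shift_index j k) 0).
Proof. by rewrite -[_ * _]/(_ *m _) -mulmxA shift_subE !laurent_shiftE. Qed.

Lemma semidiscretizationE (h c nu : R) (W W' : 'cV[R]_(N + N)) : h != 0 -> nu != 0 ->
  semidiscretization r r' p p' q q' h c nu W W' <->
  W' = (nu / h ^+ 2) *: Mmatrix n r r' p p' q q' (c * h / nu) *m W.
Proof.
move=> h0 nu0; rewrite /semidiscretization.
set Pe := c * h / nu; set s := nu / h ^+ 2.
pose w := dsubmx W; pose wb := usubmx W.
have e : s *: Mmatrix n r r' p p' q q' Pe *m W =
    col_mx (s *: (M11 *m wb + M12 Pe *m w)) (s *: (M21 Pe *m wb + M22 Pe *m w)).
  by rewrite -[W in LHS]vsubmxK -scalemxAl Mmatrix_block mul_block_col scale_col_mx.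
have subZE (X Y : 'M[R]_N) (u : 'cV_N) j :
    ((X - Pe *: Y) *m u) j 0 = (X *m u) j 0 - Pe * (Y *m u) j 0.
  by rewrite mulmxBl -scalemxAl !mxE.
have up j : (M11 *m wb + M12 Pe *m w) j 0 =
    h * Dx h p p' wb w (shift_index j 1) - h * Dx h p p' wb w j
    - Pe * (w (shift_index j 1) 0 - w j 0).
  by rewrite mxE /M12 subZE shift_subE !shift_laurentE /Dx; field.
have dn j : (M21 Pe *m wb + M22 Pe *m w) j 0 =
    h ^+ 2 * Dxx h q q' wb w j - Pe * (h * Dx h r r' wb w j).
  by rewrite mxE /M21 /M22 !subZE !laurent_shiftE /Dx /Dxx; field.
have scE (u : 'cV[R]_N) j : (s *: u) j 0 = s * u j 0 by rewrite mxE.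
rewrite e; split=> [H|-> j].
  rewrite -[W']vsubmxK; congr col_mx; apply/colP => j; have [H1 H2] := H j.
    rewrite scE up; apply: subr0_eq; rewrite -[RHS]H1 /s /Pe.
    by field; rewrite ?h0 ?nu0.
  rewrite scE dn; apply: subr0_eq; rewrite -[RHS]H2 /s /Pe.
  by field; rewrite ?h0 ?nu0.
rewrite col_mxKu col_mxKd; split.
  by rewrite scE up /s /Pe; field; rewrite ?h0 ?nu0.
by rewrite scE dn /s /Pe; field; rewrite ?h0 ?nu0.
Qed.

End Stability.

Unset Implicit Arguments.

Theorem theorem4p9 (R : realType) (r r' p p' q q' : nat)
  (hr : (r.-1 <= r' <= r)%N) (hr1 : (1 <= r + r')%N)
  (hp : (p.-1 <= p' <= p)%N) (hp1 : (1 <= p + p')%N)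
  (hq : (q.-1 <= q' <= q)%N) (hq1 : (1 <= q + q')%N) :
  (forall (n : nat) (h c nu : R), 0 < h -> 0 < nu -> 0 <= c * h / nu ->
     stable_system (@semidiscretization R n r r' p p' q q' h c nu))
  /\
  (forall (n : nat) (Pe : R), 0 <= Pe ->
     stable_mx (map_mx (real_complex R) (@Mmatrix R n r r' p p' q q' Pe))).
Proof.
split=> [n h c nu h0 nu0 _|n Pe _].
  exists ((nu / h ^+ 2) *: Mmatrix n r r' p p' q q' (c * h / nu)).
    by move=> W W'; apply: semidiscretizationE; exact: lt0r_neq0.
  by apply: stable_Mmatrix => //; rewrite divr_gt0 // exprn_gt0.
by rewrite -[Mmatrix _ _ _ _ _ _ _ _]scale1r; exact: stable_Mmatrix.
Qed.
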